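(* Let $L=M(G,*,g_0)=G\cup Gu$ be a finite RA loop and $K$ a field of characteristic not dividing $|L|$. Then the group algebra $KG=\bigoplus_i A_i$ is the direct sum of simple algebras $A_i$, each a field or a quaternion algebra, and the loop algebra $KL=\bigoplus_i (A_i+A_iu)$ is the direct sum of algebras $B_i=A_i+A_iu$, each of which is a field, or the direct sum $A_i\oplus A_i$ of two fields if $A_i$ is a field, or a Cayley algebra. Suppose further that $L$ is a loop in one of the five classes $\mathcal{L}_1,\ldots,\mathcal{L}_5$ and that there are $n$ fields and $m$ quaternion algebras in the decomposition of $KG$. Then the loop algebra $KL$ is the direct sum of $2n$ fields and $m$ Cayley algebras.
   Context: RA loops: let $G$ be a nonabelian group with $G/\mathcal{Z}(G)\cong C_2\times C_2$, where $\mathcal{Z}(G)$ is the centre; then $G'=\{1,s\}$ is central of order two. Define an involution on $G$ by $g^*=g$ if $g\in\mathcal{Z}(G)$ and $g^*=sg$ if $g\notin\mathcal{Z}(G)$. Let $g_0\in\mathcal{Z}(G)$ and let $u$ be an element not in $G$. Extend the product of $G$ to $L=G\cup Gu$ by $$g(hu)=(hg)u,\qquad (gu)h=(gh^* )u,\qquad (gu)(hu)=g_0h^*g\qquad(g,h\in G).$$ The resulting loop is denoted $M(G,*,g_0)$; these loops are the RA (ring alternative) loops, i.e. the loops whose loop rings over commutative associative coefficient rings with $1$ are alternative but not associative. The loop algebra $KL$ is the $K$-vector space with basis $L$ and multiplication extended bilinearly from $L$; thus $KL=KG+KGu$. A quaternion algebra is a $4$-dimensional central simple algebra over its centre ($2\times2$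 matrix rings over fields included). A Cayley algebra is an $8$-dimensional (nonassociative, alternative) composition algebra over a field, possibly split, obtained by the Cayley–Dickson process from a quaternion algebra. The classes $\mathcal{L}_1,\dots,\mathcal{L}_5$ consist of the loops $M(G,*,g_0)$ (so $u^2=g_0$) with $G$ and $g_0$ as follows, where in each group $t_1,t_2,t_3$ (those that occur) are central, the commutator of $x$ and $y$ is $(x,y)=s=t_1^{2^{m_1-1}}$, all $m_i\ge1$, and $t_i^{2^{m_i}}=1$: - $\mathcal{L}_1$: $G=\langle x,y,t_1\rangle$ with $x^2=y^2=1$ (class $\mathcal{D}_1$), $g_0=1$; - $\mathcal{L}_2$: $G=\langle x,y,t_1\rangle$ with $x^2=y^2=t_1$ (class $\mathcal{D}_2$), $g_0=t_1$; - $\mathcal{L}_3$: $G=\langle x,y,t_1,t_2\rangle$ with $x^2=1$, $y^2=t_2$ (class $\mathcal{D}_3$), $g_0=1$; - $\mathcal{L}_4$: $G=\langle x,y,t_1,t_2\rangle$ with $x^2=t_1$, $y^2=t_2$ (class $\mathcal{D}_4$), $g_0=t_1$; - $\mathcal{L}_5$: $G=\langle x,y,t_1,t_2,t_3\rangle$ with $x^2=t_2$, $y^2=t_3$ (class $\mathcal{D}_5$), $g_0=1$. (These are presentations; the centre of $G$ is the direct product of the cyclic groups $\langle t_i\rangle$ of order $2^{m_i}$.) *)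

(* Defs.v *)
From HB Require Import structures.
From mathcomp Require Import all_boot all_order all_algebra all_fingroup all_solvable.

Set Implicit Arguments.
Unset Strict Implicit.
Unset Printing Implicit Defensive.

Import GRing.Theory.
Local Open Scope ring_scope.

(* Algebras, not necessarily associative or unital, are K-subspaces A of a
   fixed finite-dimensional space V that are closed under a bilinear product
   mul on V; the identity of A (if any) is an element of A, unrelated to an
   identity of V. *)
Section Algebras.

Variables (K : fieldType) (V : vectType K) (mul : V -> V -> V).
Implicit Types (A B C F I Q : {vspace V}).

Definition is_algebra A : Prop := {in A &, forall x y, mul x y \in A}.

Definition is_identity A (e : V) : Prop :=
  e \in A /\ {in A, forall x, mul e x = x /\ mul x e = x}.

Definition is_ideal A I : Prop :=
  (I <= A)%VS /\ {in A & I, forall x y, mul x y \in I /\ mul y x \in I}.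

Definition is_simple A : Prop :=
  [/\ is_algebra A,
      exists x y, [/\ x \in A, y \in A & mul x y != 0] &
      forall I, is_ideal A I -> I = 0%VS \/ I = A].

Definition is_associative A : Prop :=
  {in A & &, forall x y z, mul x (mul y z) = mul (mul x y) z}.

Definition is_commutative A : Prop := {in A &, forall x y, mul x y = mul y x}.

Definition is_field A : Prop :=
  [/\ is_algebra A, is_associative A, is_commutative A &
      exists e, [/\ is_identity A e, e != 0 &
        {in A, forall x, x != 0 -> exists2 y, y \in A & mul x y = e}]].

(* z commutes and associates with everything in A *)
Definition central A (z : V) : Prop :=
  [/\ z \in A, {in A, forall x, mul z x = mul x z} &
      {in A &, forall x y,
        [/\ mul (mul z x) y = mul z (mul x y),
            mul (mul x z) y = mul x (mul z y) &
            mul (mul x y) z = mul x (mul y z)]}].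

(* A has an F-basis with d elements, F acting by multiplication on the left *)
Definition has_dim_over F A (d : nat) : Prop :=
  exists b : 'I_d -> V, (forall i, b i \in A) /\
    {in A, forall x, exists! c : {ffun 'I_d -> V},
      (forall i, c i \in F) /\ x = \sum_(i < d) mul (c i) (b i)}.

Definition is_quaternion_over F Q : Prop :=
  [/\ is_associative Q, exists e, is_identity Q e & is_simple Q] /\
  [/\ forall z, z \in F <-> central Q z, is_field F & has_dim_over F Q 4].

Definition is_quaternion Q : Prop := exists F, is_quaternion_over F Q.

Definition is_composition_over F C : Prop :=
  [/\ is_algebra C, is_field F, forall z, z \in F -> central C z &
      exists2 e, is_identity C e & e \in F] /\
  exists N : V -> V, let pol x y := N (x + y) - N x - N y in
  [/\ {in C, forall x, N x \in F},
      {in F & C, forall a x, N (mul a x) = mul (mul a a) (N x)},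
      {in C & &, forall x y z, pol (x + y) z = pol x z + pol y z} /\
      {in F & C & C, forall a x y, pol (mul a x) y = mul a (pol x y)},
      {in C, forall x, {in C, forall y, pol x y = 0} -> x = 0} &
      {in C &, forall x y, N (mul x y) = mul (N x) (N y)}].

(* On a quaternion algebra Q over F these conditions determine bar on Q. *)
Definition is_standard_involution F Q (bar : V -> V) : Prop :=
  [/\ {in Q, forall x, bar x \in Q /\ bar (bar x) = x},
      {in Q &, forall x y, bar (x + y) = bar x + bar y},
      {in F & Q, forall a x, bar (mul a x) = mul a (bar x)},
      {in Q &, forall x y, bar (mul x y) = mul (bar y) (bar x)} &
      {in Q, forall x, x + bar x \in F /\ mul x (bar x) \in F}].

(* C = Q + Qv is the Cayley-Dickson double of Q with v^2 = gam. *)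
Definition is_Cayley_Dickson_double F Q C : Prop :=
  exists (bar : V -> V) (gam v : V),
  [/\ (Q <= C)%VS /\ exists2 e, is_identity C e & e \in Q,
      is_standard_involution F Q bar,
      [/\ gam \in F, gam != 0 & v \in C],
      {in C, forall c, exists! ab : V * V,
         [/\ ab.1 \in Q, ab.2 \in Q & c = ab.1 + mul ab.2 v]} &
      {in Q &, forall a b,
         [/\ mul a (mul b v) = mul (mul b a) v,
             mul (mul a v) b = mul (mul a (bar b)) v &
             mul (mul a v) (mul b v) = mul gam (mul (bar b) a)]}].

Definition is_Cayley_over F C : Prop :=
  [/\ is_composition_over F C, has_dim_over F C 8 &
      exists2 Q, is_quaternion_over F Q & is_Cayley_Dickson_double F Q C].

Definition is_Cayley C : Prop := exists F, is_Cayley_over F C.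

Definition is_direct_sum (J : finType) (A : J -> {vspace V}) B : Prop :=
  [/\ B = (\sum_j A j)%VS, directv (\sum_j A j), forall j, is_algebra (A j) &
      forall i j, i != j -> {in A i & A j, forall x y, mul x y = 0}].

Definition algebra_iso A B : Prop :=
  exists f : 'End(V),
    [/\ {in A &, injective f}, (f @: A)%VS = B &
        {in A &, forall x y, f (mul x y) = mul (f x) (f y)}].

Definition is_wedderburn (r : nat) (A : 'I_r -> {vspace V}) B : Prop :=
  is_direct_sum A B /\ forall i, is_simple (A i).

Definition sum_of_fields_and (P : {vspace V} -> Prop) (n m : nat) B : Prop :=
  exists A : 'I_n + 'I_m -> {vspace V},
    [/\ is_direct_sum A B, forall i, is_field (A (inl i)) &
        forall j, P (A (inr j))].

End Algebras.

Section LoopAlgebra.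

Variables (K : fieldType) (L : finType) (op : L -> L -> L).

(* K^o is K as a vector space over itself. *)
Definition loop_alg : vectType K := {ffun L -> K^o}.

Definition basis_elt (l : L) : loop_alg := [ffun l' => (l' == l)%:R].

Definition loop_alg_mul (a b : loop_alg) : loop_alg :=
  \sum_l \sum_l' ((a : {ffun L -> K^o}) l * (b : {ffun L -> K^o}) l' : K)
                   *: basis_elt (op l l').

Definition loop_alg_mulr (b a : loop_alg) : loop_alg := loop_alg_mul a b.

Fact loop_alg_mulr_linear b : linear (loop_alg_mulr b).
Proof.
move=> k x y; rewrite /loop_alg_mulr /loop_alg_mul scaler_sumr -big_split /=.
apply: eq_bigr => l _; rewrite scaler_sumr -big_split /=.
apply: eq_bigr => l' _; rewrite !ffunE scalerA -scalerDl mulrDl.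
by rewrite -mulrA.
Qed.

HB.instance Definition _ b :=
  GRing.isLinear.Build K loop_alg loop_alg _ (loop_alg_mulr b)
    (loop_alg_mulr_linear b).

End LoopAlgebra.

Section RALoop.

Variable gT : finGroupType.
Local Open Scope group_scope.

(* M(G, *, g0), with G the whole of gT: inl g stands for g, inr g for gu. *)
Definition ra_loop : finType := (gT + gT)%type.

Definition ra_star (s g : gT) : gT := if g \in 'Z([set: gT]) then g else s * g.

Definition ra_mul (s g0 : gT) (a b : ra_loop) : ra_loop :=
  match a, b with
  | inl g, inl h => inl (g * h)
  | inl g, inr h => inr (h * g)
  | inr g, inl h => inr (g * ra_star s h)
  | inr g, inr h => inl (g0 * ra_star s h * g)
  end.

Definition ra_u : ra_loop := inr 1.

Variables (K : fieldType) (s g0 : gT).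

Definition KL : vectType K := loop_alg K ra_loop.

Definition KL_mul : KL -> KL -> KL := loop_alg_mul (ra_mul s g0).

Definition KG : {vspace KL} :=
  <<[seq basis_elt K (inl g : ra_loop) | g : gT]>>%VS.

Definition times_u (A : {vspace KL}) : {vspace KL} :=
  (linfun (loop_alg_mulr (ra_mul s g0) (basis_elt K ra_u)) @: A)%VS.

End RALoop.

Section Classes.
Local Open Scope group_scope.

(* gT is presented by the generators x, y, t_i and the relations R: they
   generate, satisfy R, and are universal for R.  As usual for presentations
   of finite groups in the library, only finite targets are considered. *)
Definition presented_by (k : nat)
    (R : forall hT : finGroupType, hT -> hT -> ('I_k -> hT) -> Prop)
    (gT : finGroupType) (x y : gT) (t : 'I_k -> gT) : Prop :=
  [/\ <<[set x; y] :|: [set t i | i : 'I_k]>> = [set: gT], R gT x y t &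
      forall (hT : finGroupType) (x' y' : hT) (t' : 'I_k -> hT), R hT x' y' t' ->
        exists f : {morphism [set: gT] >-> hT},
          [/\ f x = x', f y = y' & forall i, f (t i) = t' i]].

(* Indices start at 0: t 0, t 1, t 2 are t_1, t_2, t_3, with orders dividing
   2 ^ m 0, 2 ^ m 1, 2 ^ m 2. *)
Definition common_rel (k : nat) (m : 'I_k.+1 -> nat)
    (hT : finGroupType) (x y : hT) (t : 'I_k.+1 -> hT) : Prop :=
  [/\ forall i, commute (t i) x /\ commute (t i) y,
      forall i j, commute (t i) (t j),
      forall i, t i ^+ (2 ^ m i) = 1 &
      [~ x, y] = t ord0 ^+ (2 ^ (m ord0).-1)].

Definition D1_rel (m : 'I_1 -> nat) (hT : finGroupType) (x y : hT) t : Prop :=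
  [/\ common_rel m x y t, x ^+ 2 = 1 & y ^+ 2 = 1].
Definition D2_rel (m : 'I_1 -> nat) (hT : finGroupType) (x y : hT) t : Prop :=
  [/\ common_rel m x y t, x ^+ 2 = t ord0 & y ^+ 2 = t ord0].
Definition D3_rel (m : 'I_2 -> nat) (hT : finGroupType) (x y : hT) t : Prop :=
  [/\ common_rel m x y t, x ^+ 2 = 1 & y ^+ 2 = t (inord 1)].
Definition D4_rel (m : 'I_2 -> nat) (hT : finGroupType) (x y : hT) t : Prop :=
  [/\ common_rel m x y t, x ^+ 2 = t ord0 & y ^+ 2 = t (inord 1)].
Definition D5_rel (m : 'I_3 -> nat) (hT : finGroupType) (x y : hT) t : Prop :=
  [/\ common_rel m x y t, x ^+ 2 = t (inord 1) & y ^+ 2 = t (inord 2)].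

Variables (gT : finGroupType) (g0 : gT).

Definition in_L1 : Prop := exists (m : 'I_1 -> nat) (x y : gT) (t : 'I_1 -> gT),
  [/\ forall i, (0 < m i)%N, presented_by (D1_rel m) x y t & g0 = 1].
Definition in_L2 : Prop := exists (m : 'I_1 -> nat) (x y : gT) (t : 'I_1 -> gT),
  [/\ forall i, (0 < m i)%N, presented_by (D2_rel m) x y t & g0 = t ord0].
Definition in_L3 : Prop := exists (m : 'I_2 -> nat) (x y : gT) (t : 'I_2 -> gT),
  [/\ forall i, (0 < m i)%N, presented_by (D3_rel m) x y t & g0 = 1].
Definition in_L4 : Prop := exists (m : 'I_2 -> nat) (x y : gT) (t : 'I_2 -> gT),
  [/\ forall i, (0 < m i)%N, presented_by (D4_rel m) x y t & g0 = t ord0].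
Definition in_L5 : Prop := exists (m : 'I_3 -> nat) (x y : gT) (t : 'I_3 -> gT),
  [/\ forall i, (0 < m i)%N, presented_by (D5_rel m) x y t & g0 = 1].

End Classes.

(* Main.v *)
From HB Require Import structures.
Require Import Defs.
From mathcomp Require Import all_boot all_order all_algebra all_fingroup all_solvable.
From Stdlib Require Import Classical.
Set Implicit Arguments.
Unset Strict Implicit.
Unset Printing Implicit Defensive.
Import GRing.Theory.
Local Open Scope ring_scope.

(* Write KL = KG + KGu and extend * linearly to an anti-involution bar of KG,
   so that (a + bu)(c + du) = (ac + g0 bar(d) b) + (da + b bar(c)) u.  In KG both
   a + bar(a) and a bar(a) are central and the trace a + bar(a) is symmetric,
   whence a + bu |-> a bar(a) - g0 b bar(b) is multiplicative on all of KL.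
   Maschke averaging shows that every ideal of KG is KGe for a central
   idempotent e; in a simple ideal the central element s acts as 1 or -1.  If
   se = e, then KGe is a field on which bar is trivial, and its double by u is
   a field or splits, according as g0 e is a nonsquare or a square.  If se = -e,
   a transversal of the centre Z(G) is a basis of KGe over its centre, dual to
   the inverse transversal for the trace, so KGe is a quaternion algebra and its
   double is a Cayley algebra.  In the five classes g0 is a square of G, so all
   the fields split. *)

(** * Ideals, fields and direct sums of algebras *)

(** [KL] is not associative, so ring reasoning is confined to [KG], and elements of [KL] are handled
    as pairs over it. The group-theoretic core is that two commuting noncentral elements have a
    central product, because the centre has only four cosets; hence star sends gh to hg whenever g
    and h do not commute. This is what makes star an anti-automorphism and the trace symmetric.
    Since |L| = 2|G|, the characteristic condition gives two things: |G| is invertible, for the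
    averaging, and 2 is invertible, for half-traces and for the idempotents (e + tu)/2 and (e -
    tu)/2. The last claim starts from an arbitrary decomposition of [KG], so the type of a summand
    has to determine the sign of s on it. If se = -e, noncommuting g and h give ghe = -hge, and
    commutativity would force 2hge = 0. If se = e, the summand is commutative, hence its own centre,
    and cannot have dimension four over it. *)

Section Algebras.
Variables (K : fieldType) (V : vectType K) (mul : V -> V -> V).
Implicit Types A B C : {vspace V}.

Lemma algebra_iso_field A B : algebra_iso mul A B -> is_field mul A -> is_field mul B.
Proof.
case=> f [inj_f <- fM] [algA assA comA [e [[eA e1] e0 invA]]].
have f0 x : x \in A -> f x != 0 -> x != 0.
  by move=> xA; apply: contra_neq => ->; rewrite linear0.
split.
- move=> _ _ /memv_imgP[x xA ->] /memv_imgP[y yA ->].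
  by rewrite -fM // memv_img ?algA.
- move=> _ _ _ /memv_imgP[x xA ->] /memv_imgP[y yA ->] /memv_imgP[z zA ->].
  by rewrite -!fM ?algA // assA.
- move=> _ _ /memv_imgP[x xA ->] /memv_imgP[y yA ->].
  by rewrite -!fM // comA.
exists (f e); split.
- split; first exact: memv_img.
  by move=> _ /memv_imgP[x xA ->]; rewrite -!fM //; case: (e1 x xA) => -> ->.
- by apply: contra_neq e0 => fe0; apply: inj_f; rewrite ?mem0v // fe0 linear0.
move=> _ /memv_imgP[x xA ->] /(f0 _ xA)/(invA _ xA)[y yA xy].
by exists (f y); rewrite ?memv_img // -fM // xy.
Qed.

(** A nonzero element of an ideal is invertible, which puts the identity into the ideal. This lets
    the field summands of a given decomposition count as simple components. *)
Lemma field_simple A : (forall x, mul x 0 = 0) -> is_field mul A -> is_simple mul A.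
Proof.
move=> mul0 [algA assA comA [e [[eA e1] e0 invA]]]; split=> //.
  by exists e, e; rewrite (e1 e eA).1.
move=> I [sIA idI]; have [->|I0] := eqVneq I 0%VS; [by left | right].
have /andP[xI x0] : (vpick I \in I) && (vpick I != 0) by rewrite memv_pick vpick0.
have [y yA xy] := invA _ (subvP sIA _ xI) x0.
have eI : e \in I by rewrite -xy; case: (idI _ _ yA xI).
apply/eqP; rewrite eqEsubv sIA; apply/subvP => z zA.
by rewrite -(e1 z zA).1; case: (idI _ _ zA eI).
Qed.

Hypothesis mulDr : forall x y z, mul x (y + z) = mul x y + mul x z.

(** A left identity of [D i] annihilates the other summands, so multiplying a vanishing sum by it
    isolates the i-th term: directness follows from orthogonality. *)
Lemma direct_sum_intro (J : finType) (D : J -> {vspace V}) B :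
    B = (\sum_j D j)%VS -> (forall j, is_algebra mul (D j)) ->
    (forall j, exists2 e, e \in D j & {in D j, forall x, mul e x = x}) ->
    (forall i j, i != j -> {in D i & D j, forall x y, mul x y = 0}) ->
  is_direct_sum mul D B.
Proof.
move=> defB algD idD ortho; split=> //.
apply/directv_sum_independent => us usD sum0 i _.
have mul0 x : mul x 0 = 0 by apply: (addrI (mul x 0)); rewrite -mulDr !addr0.
have [e eD e1] := idD i.
rewrite -[LHS](e1 _ (usD i isT)) -[RHS](mul0 e) -sum0.
rewrite (big_morph _ (mulDr e) (mul0 e)) (bigD1 i) //= big1 ?addr0 // => j ji.
by apply: (ortho i j); rewrite ?usD // eq_sym.
Qed.

End Algebras.

(** * Loop algebras and the group algebra as a ring *)

Section LoopAlgebraTheory.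
Variables (K : fieldType) (L : finType) (op : L -> L -> L).
Implicit Types (a b c : loop_alg K L) (k : K).
Local Notation mul := (loop_alg_mul (K := K) op).
Local Notation delta := (basis_elt K).

Lemma loop_alg_mulDl : left_distributive mul +%R.
Proof. by move=> a b c; rewrite -[mul (a + b) c]/(loop_alg_mulr op c (a + b))
  linearD. Qed.

Lemma loop_alg_mulZl k a b : mul (k *: a) b = k *: mul a b.
Proof. by rewrite -[mul (k *: a) b]/(loop_alg_mulr op b (k *: a)) linearZ. Qed.

Lemma loop_alg_mulDr : right_distributive mul +%R.
Proof.
move=> a b c; rewrite /loop_alg_mul -big_split /=; apply: eq_bigr => l _.
rewrite -big_split /=; apply: eq_bigr => l' _.
by rewrite -scalerDl !ffunE mulrDr.
Qed.

Lemma loop_alg_mulZr k a b : mul a (k *: b) = k *: mul a b.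
Proof.
rewrite /loop_alg_mul scaler_sumr; apply: eq_bigr => l _.
rewrite scaler_sumr; apply: eq_bigr => l' _.
by rewrite scalerA !ffunE mulrCA.
Qed.

Lemma loop_alg_sum_delta a : a = \sum_l (a : {ffun L -> K^o}) l *: delta l.
Proof.
apply/ffunP => l; rewrite sum_ffunE (bigD1 l) //= big1 => [|l' ne].
  by rewrite !ffunE eqxx addr0 [_ *: _]mulr1.
by rewrite !ffunE eq_sym (negPf ne) scaler0.
Qed.

Lemma loop_alg_ind (P : loop_alg K L -> Prop) :
  P 0 -> (forall a b, P a -> P b -> P (a + b)) ->
  (forall k a, P a -> P (k *: a)) -> (forall l, P (delta l)) -> forall a, P a.
Proof.
move=> P0 PD PZ Pdelta a; rewrite (loop_alg_sum_delta a).
by elim/big_rec: _ => // l b _ Pb; apply: PD => //; apply: PZ.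
Qed.

Lemma loop_alg_mul_delta l l' : mul (delta l) (delta l') = delta (op l l').
Proof.
rewrite /loop_alg_mul (bigD1 l) //= (bigD1 l') //= !ffunE !eqxx mulr1 scale1r.
rewrite big1 ?addr0 => [|j ne]; last by rewrite !ffunE (negPf ne) mulr0 scale0r.
rewrite big1 ?addr0 // => i ne; apply: big1 => j _.
by rewrite !ffunE (negPf ne) mul0r scale0r.
Qed.

Lemma loop_alg_mul0l a : mul 0 a = 0.
Proof. by have := loop_alg_mulZl 0 0 a; rewrite !scale0r. Qed.

Lemma loop_alg_mul0r a : mul a 0 = 0.
Proof. by have := loop_alg_mulZr 0 a 0; rewrite !scale0r. Qed.

End LoopAlgebraTheory.

(* Convolution needs its own type name: {ffun gT -> K} already carries the
   pointwise product. *)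
Definition galg (gT : finGroupType) (K : fieldType) : Type := loop_alg K gT.

Section GroupAlgebra.
Variables (gT : finGroupType) (K : fieldType).

HB.instance Definition _ := GRing.Lmodule.copy (galg gT K) (loop_alg K gT).

Definition galg_mul (a b : galg gT K) : galg gT K := loop_alg_mul mulg a b.
Definition gelt (g : gT) : galg gT K := basis_elt K g.

Lemma galg_ind (P : galg gT K -> Prop) :
  P 0 -> (forall a b, P a -> P b -> P (a + b)) ->
  (forall k a, P a -> P (k *: a)) -> (forall g, P (gelt g)) -> forall a, P a.
Proof. exact: (@loop_alg_ind K gT P). Qed.

Fact galg_mulDl : left_distributive galg_mul +%R.
Proof. exact: loop_alg_mulDl. Qed.

Fact galg_mulDr : right_distributive galg_mul +%R.
Proof. exact: loop_alg_mulDr. Qed.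

Fact galg_mulZl k (a b : galg gT K) : galg_mul (k *: a) b = k *: galg_mul a b.
Proof. exact: loop_alg_mulZl. Qed.

Fact galg_mulZr k (a b : galg gT K) : galg_mul a (k *: b) = k *: galg_mul a b.
Proof. exact: loop_alg_mulZr. Qed.

Fact galg_mul_gelt g h : galg_mul (gelt g) (gelt h) = gelt (g * h).
Proof. exact: loop_alg_mul_delta. Qed.

Fact galg_mul0l a : galg_mul 0 a = 0. Proof. exact: loop_alg_mul0l. Qed.
Fact galg_mul0r a : galg_mul a 0 = 0. Proof. exact: loop_alg_mul0r. Qed.

Fact galg_mulA : associative galg_mul.
Proof.
move=> a b c; elim/galg_ind: a => [|a a' IH IH'|k a IH|g].
- by rewrite !galg_mul0l.
- by rewrite !galg_mulDl IH IH'.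
- by rewrite !galg_mulZl IH.
elim/galg_ind: b => [|b b' IH IH'|k b IH|h].
- by rewrite galg_mul0r galg_mul0l galg_mul0r.
- by rewrite !galg_mulDl !galg_mulDr galg_mulDl IH IH'.
- by rewrite !galg_mulZl !galg_mulZr galg_mulZl IH.
elim/galg_ind: c => [|c c' IH IH'|k c IH|h'].
- by rewrite !galg_mul0r.
- by rewrite !galg_mulDr IH IH'.
- by rewrite !galg_mulZr IH.
by rewrite !galg_mul_gelt mulgA.
Qed.

Fact galg_mul1l : left_id (gelt 1) galg_mul.
Proof.
elim/galg_ind => [|a b IHa IHb|k a IH|g]; rewrite ?galg_mul0r //.
- by rewrite galg_mulDr IHa IHb.
- by rewrite galg_mulZr IH.
- by rewrite galg_mul_gelt mul1g.
Qed.

Fact galg_mul1r : right_id (gelt 1) galg_mul.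
Proof.
elim/galg_ind => [|a b IHa IHb|k a IH|g]; rewrite ?galg_mul0l //.
- by rewrite galg_mulDl IHa IHb.
- by rewrite galg_mulZl IH.
- by rewrite galg_mul_gelt mulg1.
Qed.

Fact galg_1_neq0 : gelt 1 != 0.
Proof.
apply/eqP => /ffunP/(_ 1%g)/eqP.
by rewrite !ffunE eqxx oner_eq0.
Qed.

HB.instance Definition _ := GRing.Zmodule_isNzRing.Build (galg gT K)
  galg_mulA galg_mul1l galg_mul1r galg_mulDl galg_mulDr galg_1_neq0.
HB.instance Definition _ :=
  GRing.Lmodule_isLalgebra.Build K (galg gT K) (fun k a b => esym (galg_mulZl k a b)).
HB.instance Definition _ :=
  GRing.Lalgebra_isAlgebra.Build K (galg gT K) (fun k a b => esym (galg_mulZr k a b)).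

Lemma geltM g h : gelt (g * h) = gelt g * gelt h.
Proof. by rewrite -galg_mul_gelt. Qed.

Lemma gelt1 : gelt 1 = 1. Proof. by []. Qed.

End GroupAlgebra.

(** * Groups whose central quotient is a Klein four-group *)

Section RAGroup.
Variables (gT : finGroupType) (s : gT).
Local Open Scope group_scope.
Hypothesis G_mod_Z : [set: gT] / 'Z([set: gT]) \isog [set: ('Z_2 * 'Z_2)%type].
Hypothesis s_neq1 : s != 1.
Hypothesis G_der : [set: gT]^`(1) = [set 1; s].
Local Notation Z := 'Z([set: gT]).
Local Notation star := (ra_star s).

Lemma center_commute z g : z \in Z -> commute z g.
Proof. by case/centerP=> _ /(_ g (in_setT g)). Qed.

Lemma in_center z : (forall g, commute z g) -> z \in Z.
Proof. by move=> cz; apply/centerP; split=> // g _; apply: cz. Qed.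

Lemma s_mem_der : s \in [set: gT]^`(1). Proof. by rewrite G_der set22. Qed.

Lemma s_central : s \in Z.
Proof.
apply: in_center => g; apply/commgP/conjg_fixP.
have: s ^ g \in [set: gT]^`(1).
  by rewrite memJ_norm ?s_mem_der // (subsetP (der_norm 1 _)) ?in_setT.
by rewrite G_der !inE conjg_eq1 (negPf s_neq1) => /eqP.
Qed.

Lemma s_sq : s * s = 1.
Proof.
have: s * s \in [set: gT]^`(1) by rewrite groupM ?s_mem_der.
rewrite G_der !inE => /orP[/eqP //|/eqP e].
by case/eqP: s_neq1; apply: (mulgI s); rewrite e mulg1.
Qed.

Lemma commute_or_s g h : g * h = h * g \/ g * h = s * (h * g).
Proof.
have: [~ g, h] \in [set: gT]^`(1) by rewrite mem_commg ?in_setT.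
rewrite G_der !inE => /orP[/commgP|/eqP e]; [by left | right].
by rewrite (center_commute _ s_central) -e /commg /conjg !mulgA mulgK mulgV mul1g.
Qed.

Lemma star_central g : g \in Z -> star g = g. Proof. by rewrite /ra_star => ->. Qed.

Lemma star_noncentral g : g \notin Z -> star g = s * g.
Proof. by rewrite /ra_star => /negPf->. Qed.

Lemma starK : involutive star.
Proof.
move=> g; rewrite {2}/ra_star; case: ifP => [|/negbT] gZ; first exact: star_central.
by rewrite star_noncentral ?groupMl ?s_central // mulgA s_sq mul1g.
Qed.

Lemma card_G_mod_Z : #|[set: gT] / Z| = 4%N.
Proof. by rewrite (card_isog G_mod_Z) cardsT card_prod !card_ord. Qed.

Lemma coset_eq1 g : (coset Z g == 1) = (g \in Z).
Proof. by apply/eqP/idP=> [/coset_idr|/coset_id]; first by apply;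
  rewrite (subsetP (normal_norm (center_normal _))) ?in_setT. Qed.

Lemma cosetM g h : coset Z (g * h) = coset Z g * coset Z h.
Proof. by rewrite morphM // (subsetP (normal_norm (center_normal _))) ?in_setT. Qed.

Lemma cosetV g : coset Z g^-1 = (coset Z g)^-1.
Proof. by rewrite morphV // (subsetP (normal_norm (center_normal _))) ?in_setT. Qed.

Lemma coset_in_quotient (g : gT) : coset Z g \in [set: gT] / Z.
Proof. by rewrite mem_quotient ?in_setT. Qed.

(** The quotient by the centre has exponent two. *)
Lemma sq_central g : g * g \in Z.
Proof.
rewrite -coset_eq1 cosetM.
case/isogP: G_mod_Z => f inj_f _; have fg := coset_in_quotient g.
rewrite -(morph_injm_eq1 inj_f) ?groupM // morphM //.
have Z2sq (a : 'Z_2) : a * a = 1 by case: a => [[|[|[]]]] // i; apply: val_inj.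
by case: (f _) => a b; apply/eqP; congr pair; apply: Z2sq.
Qed.

(* A four-element quotient leaves room for no element outside the subgroup
   generated by the centre and two independent elements. *)
Lemma commute_central g h : g \notin Z -> h \notin Z -> commute g h -> g * h \in Z.
Proof.
move=> gZ hZ cgh; apply: contraNT (gZ) => ghZ; apply: in_center => k.
(* If a and b had the same coset, ab would be congruent to bb, which is central. *)
have neq a b : a * b \notin Z -> coset Z a != coset Z b.
  apply: contra => /eqP e.
  by rewrite -coset_eq1 cosetM e -cosetM coset_eq1 sq_central.
pose S := [:: coset Z 1; coset Z g; coset Z h; coset Z (g * h)].
have uS : uniq S.
  rewrite /= !inE !negb_or !neq ?mul1g // ?mulgA.
  - by rewrite -cgh -mulgA groupMr ?sq_central.
  - by rewrite groupMl ?sq_central.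
have kS : coset Z k \in [set a in S].
  have /eqP-> : [set a in S] == [set: gT] / Z; last exact: coset_in_quotient.
  rewrite eqEcard cardsE (card_uniqP uS) card_G_mod_Z leqnn andbT.
  apply/subsetP=> q; rewrite !inE.
  by case/or4P=> /eqP->; rewrite coset_in_quotient.
(* k is a central multiple of 1, g, h or gh, and each of these commutes with g. *)
have comm_of a : coset Z k = coset Z a -> commute g a -> commute g k.
  move=> e cga; rewrite -[k](mulgKV a).
  apply: commuteM => //; apply/commute_sym/center_commute.
  by rewrite -coset_eq1 cosetM cosetV e mulgV.
rewrite !inE in kS.
by case/or4P: kS => /eqP/comm_of; apply; do ?[exact: commute1 | apply: commuteM].
Qed.

(** For noncentral g and h the two factors s cancel, leaving hg. If gh is central, then g and h
    commute; if it is not, [commute_central] forbids them to commute, and gh = s hg. *)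
Lemma starM g h : star (g * h) = star h * star g.
Proof.
rewrite /ra_star; have [gZ|gZ] := boolP (g \in Z).
  by rewrite groupMl //; case: ifP => _; rewrite ?(center_commute h gZ) // mulgA.
have [hZ|hZ] := boolP (h \in Z).
  rewrite groupMr // (negPf gZ) (center_commute _ s_central) -(center_commute _
    s_central).
  by rewrite -(center_commute g hZ) !mulgA (center_commute s hZ).
rewrite !mulgA -(mulgA s h s) -(center_commute h s_central) mulgA s_sq mul1g.
case: ifPn => ghZ.
  by apply: (mulgI g); rewrite -(center_commute g ghZ) !mulgA.
rewrite -mulgA; have [e|->] := commute_or_s g h; last by rewrite mulgA s_sq mul1g.
by rewrite (commute_central gZ hZ e) in ghZ.
Qed.

(** The source of the symmetry of the trace: for noncommuting g and h, the trace of gh is gh +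
    hg. *)
Lemma star_swap g h : g * h <> h * g -> star (g * h) = h * g.
Proof.
move=> ncgh; rewrite star_noncentral; last first.
  apply/negP=> ghZ; apply: ncgh.
  by apply: (mulgI g); rewrite -(center_commute g ghZ) !mulgA.
by have [|->] := commute_or_s g h; rewrite // mulgA s_sq mul1g.
Qed.

Lemma mul_star_central g : g * star g \in Z.
Proof.
rewrite /ra_star; case: ifP => gZ; first by rewrite groupM.
by rewrite mulgA -(center_commute g s_central) -mulgA groupM ?s_central ?sq_central.
Qed.

End RAGroup.

(** * The involution, the trace and the norm of the group algebra *)

(** As star is an involution, composing coefficients with it is the linear extension of star. *)
Definition galg_bar (gT : finGroupType) (K : fieldType) (s : gT) (a : galg gT K)
  : galg gT K :=
  [ffun g => (a : {ffun gT -> K^o}) (ra_star s g)].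

Fact galg_bar_linear gT K s : linear (@galg_bar gT K s).
Proof. by move=> k a b; apply/ffunP=> g; rewrite !ffunE. Qed.

HB.instance Definition _ (gT : finGroupType) (K : fieldType) (s : gT) :=
  GRing.isLinear.Build K (galg gT K) (galg gT K) _ (@galg_bar gT K s)
    (@galg_bar_linear gT K s).

Definition galg_central (gT : finGroupType) (K : fieldType) (z : galg gT K) :
  Prop := forall a, z * a = a * z.

Definition galg_norm (gT : finGroupType) (K : fieldType) (s : gT) (a : galg gT K)
  : galg gT K := a * galg_bar s a.

Section Center.
Variables (gT : finGroupType) (K : fieldType).
Implicit Types (z w a : galg gT K).

Lemma galg_central0 : galg_central (0 : galg gT K).
Proof. by move=> a; rewrite mul0r mulr0. Qed.

Lemma galg_centralD z w : galg_central z -> galg_central w -> galg_central (z + w).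
Proof. by move=> cz cw a; rewrite mulrDl mulrDr cz cw. Qed.

Lemma galg_centralZ k z : galg_central z -> galg_central (k *: z).
Proof. by move=> cz a; rewrite -scalerAl -scalerAr cz. Qed.

Lemma galg_centralN z : galg_central z -> galg_central (- z).
Proof. by rewrite -scaleN1r; apply: galg_centralZ. Qed.

Lemma galg_centralB z w : galg_central z -> galg_central w -> galg_central (z - w).
Proof. by move=> cz cw; apply: galg_centralD => //; apply: galg_centralN. Qed.

Lemma galg_centralM z w : galg_central z -> galg_central w -> galg_central (z * w).
Proof. by move=> cz cw a; rewrite -mulrA cw mulrA cz mulrA. Qed.

Lemma galg_mulCA z a b : galg_central z -> a * (z * b) = z * (a * b).
Proof. by move=> cz; rewrite mulrA -cz mulrA. Qed.

Lemma galg_central_gelt g : g \in 'Z([set: gT])%g -> galg_central (gelt K g).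
Proof.
move=> gZ; elim/galg_ind => [|a b IHa IHb|k a IH|h]; first by rewrite mul0r mulr0.
- by rewrite mulrDl mulrDr IHa IHb.
- by rewrite -scalerAl -scalerAr IH.
- by rewrite -!geltM (center_commute h gZ).
Qed.

Lemma galg_central_geltP z : (forall h, z * gelt K h = gelt K h * z) -> galg_central z.
Proof.
move=> cz; elim/galg_ind => [|a b IHa IHb|k a IH|h]; first by rewrite mul0r mulr0.
- by rewrite mulrDl mulrDr IHa IHb.
- by rewrite -scalerAl -scalerAr IH.
- exact: cz.
Qed.

Lemma gelt_mull_coef k a g :
  (gelt K k * a : {ffun gT -> K^o}) g = (a : {ffun gT -> K^o}) (k^-1 * g)%g.
Proof.
elim/galg_ind: a => [|a b IHa IHb|c a IH|h]; first by rewrite mulr0 !ffunE.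
- by rewrite mulrDr ffunE IHa IHb ffunE.
- by rewrite -scalerAr ffunE IH ffunE.
- by rewrite -geltM !ffunE -[_ == h](can_eq (mulKg k)) mulKVg.
Qed.

Lemma gelt_mulr_coef k a g :
  (a * gelt K k : {ffun gT -> K^o}) g = (a : {ffun gT -> K^o}) (g * k^-1)%g.
Proof.
elim/galg_ind: a => [|a b IHa IHb|c a IH|h]; first by rewrite mul0r !ffunE.
- by rewrite mulrDl ffunE IHa IHb ffunE.
- by rewrite -scalerAl ffunE IH ffunE.
- by rewrite -geltM !ffunE -[_ == h](can_eq (mulgK k)) mulgKV.
Qed.

(** Constancy on conjugacy classes, since kg and gk are conjugate. *)
Lemma galg_central_coef z g k : galg_central z ->
  (z : {ffun gT -> K^o}) (k * g)%g = (z : {ffun gT -> K^o}) (g * k)%g.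
Proof.
by move=> cz; rewrite -[k in LHS]invgK -gelt_mull_coef -cz gelt_mulr_coef invgK.
Qed.

End Center.

(** Additive bookkeeping for the polar form: the x and y are norms, [t1] and [t2] the cross
    terms. *)
Lemma zmod_polar_eq (U : zmodType) (x1 x2 t1 y1 y2 t2 : U) :
  x1 + x2 + t1 - (y1 + y2 + t2) - (x1 - y1) - (x2 - y2) = t1 - t2.
Proof.
rewrite [- (y1 + _ + _)]opprD addrACA [- (y1 + _)]opprD [x1 + _ + _]addrACA.
by rewrite -[x1 - y1 + _ + _]addrA [x1 - y1 + _]addrC addrK [x2 - y2 + _]addrC addrK.
Qed.

(** Additive bookkeeping for multiplicativity of the norm: [t] is the cross term common to both
    sides. *)
Lemma zmod_norm_eq (U : zmodType) (x t w y z : U) :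
  x + t + w - (y + t + z) = x - y - (z - w).
Proof.
rewrite [x + t + w]addrAC [y + t + z]addrAC opprD addrACA subrr addr0 !opprD opprK.
by rewrite -addrA [w + _]addrC !addrA addrAC.
Qed.

Section Involution.
Variables (gT : finGroupType) (K : fieldType) (s : gT).
Hypothesis G_mod_Z : ([set: gT] / 'Z([set: gT]))%g \isog [set: ('Z_2 * 'Z_2)%type].
Hypothesis s_neq1 : s != 1%g.
Hypothesis G_der : ([set: gT]^`(1))%g = [set 1%g; s].
Local Notation Z := 'Z([set: gT])%g.
Local Notation star := (ra_star s).
Local Notation W := (galg gT K).
Local Notation bar := (@galg_bar gT K s).
Local Notation gelt := (@gelt gT K).
Implicit Types (a b c z w : W).

Lemma bar_gelt g : bar (gelt g) = gelt (star g).
Proof. by apply/ffunP=> h; rewrite !ffunE -(can_eq (starK s_neq1 G_der)) (starK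
  s_neq1 G_der). Qed.

Lemma barK : involutive bar.
Proof. by move=> a; apply/ffunP=> h; rewrite !ffunE (starK s_neq1 G_der). Qed.

Lemma barM a b : bar (a * b) = bar b * bar a.
Proof.
elim/galg_ind: a => [|a a' IH IH'|k a IH|g]; first by rewrite mul0r !linear0 mulr0.
- by rewrite mulrDl !raddfD mulrDr /= IH IH'.
- by rewrite -scalerAl !linearZ /= IH scalerAr.
elim/galg_ind: b => [|b b' IH IH'|k b IH|h]; first by rewrite mulr0 !linear0 mul0r.
- by rewrite mulrDr !raddfD mulrDl /= IH IH'.
- by rewrite -scalerAr !linearZ /= IH scalerAl.
by rewrite -geltM !bar_gelt starM // geltM.
Qed.

(** A noncentral g fails to commute with some k, and then g is conjugate to sg, so a central element
    has equal coefficients at g and sg. *)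
Lemma bar_central z : galg_central z -> bar z = z.
Proof.
move=> cz; apply/ffunP => g; rewrite ffunE /ra_star; case: ifP => // /negP gZ.
have [k ncgk] : exists k, (g * k != k * g)%g.
  case: (pickP (fun k => g * k != k * g)%g) => [k|cg]; first by exists k.
  by case: gZ; apply: in_center => k; apply/eqP/negbFE/cg.
have [e|e] := commute_or_s s_neq1 G_der g k; first by rewrite e eqxx in ncgk.
have cs := center_commute _ (s_central s_neq1 G_der).
by rewrite -[g in RHS](mulgK k) e -[RHS]galg_central_coef // (cs (k * g)%g)
  -mulgA mulKg cs.
Qed.

(** For noncentral g the trace is g + sg, and conjugation either fixes or swaps the two terms. *)
Lemma trace_central a : galg_central (a + bar a).
Proof.
elim/galg_ind: a => [|a b IHa IHb|k a IH|g].
- by rewrite linear0 addr0; apply: galg_central0.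
- by rewrite raddfD addrACA; apply: galg_centralD.
- by rewrite linearZ -scalerDr; apply: galg_centralZ.
rewrite bar_gelt /ra_star; case: ifP => gZ.
  by apply: galg_centralD; apply: galg_central_gelt.
have cs := center_commute _ (s_central s_neq1 G_der).
apply: galg_central_geltP => h; rewrite mulrDl mulrDr -!geltM.
have -> : (h * (s * g) = s * (h * g))%g by rewrite mulgA -(cs h) mulgA.
rewrite -mulgA; have [-> //|->] := commute_or_s s_neq1 G_der g h.
by rewrite addrC (mulgA s s) (s_sq s_neq1 G_der) mul1g.
Qed.

Lemma trace_mulC a b : a * b + bar (a * b) = b * a + bar (b * a).
Proof.
elim/galg_ind: a => [|a a' IH IH'|k a IH|g]; first by rewrite mul0r mulr0.
- by rewrite mulrDl mulrDr !raddfD /= addrACA IH IH' addrACA.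
- by rewrite -scalerAl -scalerAr linearZ -scalerDr IH linearZ -scalerDr.
elim/galg_ind: b => [|b b' IH IH'|k b IH|h]; first by rewrite mulr0 mul0r.
- by rewrite mulrDl mulrDr !raddfD /= addrACA IH IH' addrACA.
- by rewrite -scalerAl -scalerAr linearZ -scalerDr IH linearZ -scalerDr.
rewrite -!geltM !bar_gelt.
have [-> //|/eqP ne] := eqVneq (g * h)%g (h * g)%g.
rewrite (star_swap s_neq1 G_der ne) (star_swap s_neq1 G_der (fun e => ne (esym e))).
exact: addrC.
Qed.

(** The norm is not additive, but its cross terms a bar(b) + b bar(a) form a trace, hence are
    central; this makes linear induction possible. *)
Lemma norm_central a : galg_central (galg_norm s a).
Proof.
rewrite /galg_norm.
elim/galg_ind: a => [|a b IHa IHb|k a IH|g].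
- by rewrite mul0r; apply: galg_central0.
- rewrite raddfD /= mulrDl !mulrDr [b * bar a + _]addrC addrACA.
  apply: galg_centralD; first exact: galg_centralD.
  by rewrite -[b in b * bar a]barK -barM; apply: trace_central.
- by rewrite linearZ -scalerAl -scalerAr; do 2![apply: galg_centralZ].
- by rewrite bar_gelt -geltM; apply/galg_central_gelt/mul_star_central.
Qed.

(** a commutes with its own trace. *)
Lemma norm_comm a : a * bar a = bar a * a.
Proof.
have := trace_central a a; rewrite mulrDl mulrDr.
by move/addrI => ->.
Qed.

Lemma galg_normD a b :
  galg_norm s (a + b) = galg_norm s a + galg_norm s b + (a * bar b + bar (a * bar b)).
Proof.
rewrite /galg_norm raddfD /= mulrDl !mulrDr [b * _ + _]addrC addrACA.
by rewrite barM barK.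
Qed.

Lemma galg_normM a b : galg_norm s (a * b) = galg_norm s a * galg_norm s b.
Proof.
rewrite {1}/galg_norm barM -mulrA [b * _]mulrA -/(galg_norm s b).
by rewrite galg_mulCA; [exact: norm_central | exact: norm_central].
Qed.

Lemma galg_norm_bar a : galg_norm s (bar a) = galg_norm s a.
Proof. by rewrite /galg_norm barK norm_comm. Qed.

Lemma galg_norm_centralE z : galg_central z -> galg_norm s z = z * z.
Proof. by move=> cz; rewrite /galg_norm bar_central. Qed.

(* The trace is symmetric, so the cross terms of the two norms on the left
   cancel. *)
Lemma galg_norm_mul z a b c d : galg_central z ->
  galg_norm s (a * c + z * bar d * b) - z * galg_norm s (d * a + b * bar c) =
  (galg_norm s a - z * galg_norm s b) * (galg_norm s c - z * galg_norm s d).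
Proof.
move=> cz; rewrite !galg_normD !galg_normM !galg_norm_bar (galg_norm_centralE cz).
(* Up to the factor z, both cross terms are traces of one word, a c bar(b) d and d a c bar(b), which
   differ by a cyclic shift. *)
have -> : a * c * bar (z * bar d * b) + bar (a * c * bar (z * bar d * b)) =
    z * (d * a * bar (b * bar c) + bar (d * a * bar (b * bar c))).
  have -> : a * c * bar (z * bar d * b) = z * (a * (c * bar b) * d).
    rewrite !barM barK [bar z]bar_central // -[d * z]cz !(galg_mulCA _ _ cz).
    by rewrite !mulrA.
  rewrite [bar (z * _)]barM [bar z]bar_central // -[bar _ * z]cz.
  rewrite -mulrDr (trace_mulC (a * (c * bar b)) d).
  by rewrite [bar (b * bar c)]barM barK [d * (a * _)]mulrA.
have [[ca cb] cd] := (norm_central a, norm_central b, norm_central d).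
(* What remains uses only that the norms are central, so norms and cross term are generalized. *)
move: (galg_norm s a) (galg_norm s b) (galg_norm s c) (galg_norm s d) (_ + bar _)
  ca cb cd.
move=> na nb nc nd t ca cb cd.
rewrite mulrBl !mulrBr !mulrDr [X in X - _]addrAC [X in _ - X]addrAC zmod_norm_eq.
rewrite (galg_mulCA na) // (cd na) -[z * nb * nc]mulrA -[z * nb * (z * nd)]mulrA.
by rewrite (galg_mulCA nb) // -!mulrA (cd nb).
Qed.

End Involution.

(** * The product of KL on pairs *)

Section LoopPairs.
Variables (gT : finGroupType) (K : fieldType) (s g0 : gT).
Hypothesis s_neq1 : s != 1%g.
Hypothesis G_der : ([set: gT]^`(1))%g = [set 1%g; s].
Hypothesis g0_central : g0 \in 'Z([set: gT])%g.
Local Notation W := (galg gT K).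
Local Notation V := (KL gT K).
Local Notation bar := (@galg_bar gT K s).
Local Notation mul := (KL_mul (K := K) s g0).
Local Notation gam := (gelt K g0).
Implicit Types (a b c d : W) (x y : V).

(* [lpair a b] is a + bu. *)
Definition lpair (a b : galg gT K) : KL gT K :=
  [ffun l : ra_loop gT => match l with
    | inl g => (a : {ffun gT -> K^o}) g
    | inr g => (b : {ffun gT -> K^o}) g end].
Definition lfst (x : KL gT K) : galg gT K := [ffun g => (x : {ffun ra_loop gT ->
  K^o}) (inl g)].
Definition lsnd (x : KL gT K) : galg gT K := [ffun g => (x : {ffun ra_loop gT ->
  K^o}) (inr g)].

Lemma lfstK a b : lfst (lpair a b) = a.
Proof. by apply/ffunP=> g; rewrite !ffunE. Qed.
Lemma lsndK a b : lsnd (lpair a b) = b.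
Proof. by apply/ffunP=> g; rewrite !ffunE. Qed.
Lemma lpair_eta x : x = lpair (lfst x) (lsnd x).
Proof. by apply/ffunP=> -[g|g]; rewrite !ffunE. Qed.
Lemma lpair_inj a b c d : lpair a b = lpair c d -> a = c /\ b = d.
Proof. by move=> e; split; [rewrite -(lfstK a b) e lfstK | rewrite -(lsndK a b) e
  lsndK]. Qed.
Lemma lpairD a b c d : lpair a b + lpair c d = lpair (a + c) (b + d).
Proof. by apply/ffunP=> -[g|g]; rewrite !ffunE. Qed.
Lemma lpairZ k a b : k *: lpair a b = lpair (k *: a) (k *: b).
Proof. by apply/ffunP=> -[g|g]; rewrite !ffunE. Qed.
Lemma lpairN a b : - lpair a b = lpair (- a) (- b).
Proof. by rewrite -scaleN1r lpairZ !scaleN1r. Qed.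
Lemma lpairB a b c d : lpair a b - lpair c d = lpair (a - c) (b - d).
Proof. by rewrite lpairN lpairD. Qed.
Lemma lpair0 : lpair 0 0 = 0.
Proof. by apply/ffunP=> -[g|g]; rewrite !ffunE. Qed.
Lemma lpair_eq0 a b : lpair a b = 0 -> a = 0 /\ b = 0.
Proof. by rewrite -lpair0; apply: lpair_inj. Qed.
Lemma lpair_sum I (r : seq I) (P : pred I) (f g : I -> W) :
  \sum_(i <- r | P i) lpair (f i) (g i) = lpair (\sum_(i <- r | P i) f i)
    (\sum_(i <- r | P i) g i).
Proof. by elim/big_rec3: _ => [|i u v w _ ->]; rewrite ?lpair0 ?lpairD. Qed.

Lemma lpair_inl g : lpair (gelt K g) 0 = basis_elt K (inl g : ra_loop gT).
Proof. by apply/ffunP=> -[h|h]; rewrite !ffunE. Qed.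
Lemma lpair_inr g : lpair 0 (gelt K g) = basis_elt K (inr g : ra_loop gT).
Proof. by apply/ffunP=> -[h|h]; rewrite !ffunE. Qed.

Lemma KL_mulDl x y z : mul (x + y) z = mul x z + mul y z.
Proof. exact: loop_alg_mulDl. Qed.
Lemma KL_mulDr x y z : mul x (y + z) = mul x y + mul x z.
Proof. exact: loop_alg_mulDr. Qed.
Lemma KL_mulZl k x y : mul (k *: x) y = k *: mul x y.
Proof. exact: loop_alg_mulZl. Qed.
Lemma KL_mulZr k x y : mul x (k *: y) = k *: mul x y.
Proof. exact: loop_alg_mulZr. Qed.
Lemma KL_mul0l x : mul 0 x = 0. Proof. exact: loop_alg_mul0l. Qed.
Lemma KL_mul0r x : mul x 0 = 0. Proof. exact: loop_alg_mul0r. Qed.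
Lemma KL_mul_suml I (r : seq I) (P : pred I) (f : I -> V) x :
  mul (\sum_(i <- r | P i) f i) x = \sum_(i <- r | P i) mul (f i) x.
Proof. by elim/big_rec2: _ => [|i u v _ <-]; rewrite ?KL_mul0l ?KL_mulDl. Qed.
Lemma KL_mul_sumr I (r : seq I) (P : pred I) (f : I -> V) x :
  mul x (\sum_(i <- r | P i) f i) = \sum_(i <- r | P i) mul x (f i).
Proof. by elim/big_rec2: _ => [|i u v _ <-]; rewrite ?KL_mul0r ?KL_mulDr. Qed.

(** By bilinearity this splits into four rules for products of [KG] and [KGu], which on group
    elements are the rules defining the loop. *)
Lemma lpair_mul a b c d :
  mul (lpair a b) (lpair c d) = lpair (a * c + gam * bar d * b) (d * a + b * bar c).
Proof.
have split p q : lpair p q = lpair p 0 + lpair 0 q by rewrite lpairD addr0 add0r.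
suff [M1 M2 M3 M4] : [/\ forall p q, mul (lpair p 0) (lpair q 0) = lpair (p * q) 0,
  forall p q, mul (lpair p 0) (lpair 0 q) = lpair 0 (q * p),
  forall p q, mul (lpair 0 p) (lpair q 0) = lpair 0 (p * bar q) &
  forall p q, mul (lpair 0 p) (lpair 0 q) = lpair (gam * bar q * p) 0].
  rewrite (split a b) (split c d) !KL_mulDl !KL_mulDr M1 M2 M3 M4 !lpairD.
  by rewrite !addr0 !add0r.
have scaler_dl0 k p : lpair (k *: p) 0 = k *: lpair p 0 by rewrite lpairZ scaler0.
have scaler_dr0 k p : lpair 0 (k *: p) = k *: lpair 0 p by rewrite lpairZ scaler0.
have addl p q : lpair (p + q) 0 = lpair p 0 + lpair q 0 by rewrite lpairD addr0.
have addrr p q : lpair 0 (p + q) = lpair 0 p + lpair 0 q by rewrite lpairD addr0.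
split=> p q.
all: elim/galg_ind: p => [|p p' IH IH'|k p IH|g];
  rewrite ?mul0r ?mulr0 ?lpair0 ?KL_mul0l ?mulrDl ?mulrDr ?addl ?addrr ?KL_mulDl
    ?IH ?IH' //;
  rewrite -?scalerAr -?scalerAl ?scaler_dl0 ?scaler_dr0 ?KL_mulZl ?IH //.
all: elim/galg_ind: q => [|p p' IH IH'|k p IH|h];
  rewrite ?linear0 ?mul0r ?mulr0 ?mul0r ?lpair0 ?KL_mul0r ?raddfD ?mulrDl ?mulrDr
    ?mulrDl ?addl ?addrr ?KL_mulDr ?IH ?IH' //;
  rewrite ?linearZ /= -?scalerAr -?scalerAl ?scaler_dl0 ?scaler_dr0 ?KL_mulZr ?IH //.
all: rewrite ?bar_gelt // -!geltM ?lpair_inl ?lpair_inr; exact: loop_alg_mul_delta.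
Qed.

Lemma mem_KG x : (x \in KG gT K) <-> exists a, x = lpair a 0.
Proof.
split=> [|[a ->]].
  move/coord_span ->.
  have: forall i, exists a : W, [seq basis_elt K (inl g : ra_loop gT) | g :
    gT]`_i = lpair a 0.
    move=> i; have [|] := ltnP i (size [seq basis_elt K (inl g : ra_loop gT) | g : gT]).
      by move/(mem_nth 0)/mapP => [g _ ->]; exists (gelt K g); rewrite lpair_inl.
    by move/(nth_default 0) ->; exists 0; rewrite lpair0.
  move=> basis; elim/big_rec: _ => [|i y _ [a ->]]; first by exists 0; rewrite lpair0.
  have [b ->] := basis i; rewrite lpairZ lpairD scaler0 addr0.
  by eexists.
elim/galg_ind: a => [|a b IHa IHb|k a IH|g].
- by rewrite lpair0 mem0v.
- by rewrite -[0]addr0 -lpairD memvD.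
- by rewrite -[0](scaler0 _ k) -lpairZ memvZ.
- by rewrite lpair_inl memv_span //; apply/mapP; exists g; rewrite ?mem_enum.
Qed.

End LoopPairs.

(** * Components of the group algebra and their doubles *)

(** Packaged as a linear map of [KL] so that the centre of a component can be given as an image,
    hence as a subspace. *)
Definition KL_trace (gT : finGroupType) (K : fieldType) (s : gT) (x : KL gT K) :
  KL gT K :=
  lpair (lfst x + galg_bar s (lfst x)) 0.

Fact KL_trace_linear gT K s : linear (@KL_trace gT K s).
Proof.
move=> k x y; rewrite /KL_trace lpairZ lpairD scaler0 addr0; congr lpair.
have -> : lfst (k *: x + y) = k *: lfst x + lfst y by apply/ffunP=> g; rewrite !ffunE.
by rewrite raddfD /= linearZ /= addrACA scalerDr.
Qed.

HB.instance Definition _ (gT : finGroupType) (K : fieldType) (s : gT) :=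
  GRing.isLinear.Build K (KL gT K) (KL gT K) _ (@KL_trace gT K s)
    (@KL_trace_linear gT K s).

Section Components.
Variables (gT : finGroupType) (s g0 : gT) (K : fieldType).
Hypothesis G_mod_Z : ([set: gT] / 'Z([set: gT]))%g \isog [set: ('Z_2 * 'Z_2)%type].
Hypothesis s_neq1 : s != 1%g.
Hypothesis G_der : ([set: gT]^`(1))%g = [set 1%g; s].
Hypothesis g0_central : g0 \in 'Z([set: gT])%g.
Hypothesis two_neq0 : 2%:R != 0 :> K.
Hypothesis card_neq0 : #|gT|%:R != 0 :> K.

Local Notation Z := 'Z([set: gT])%g.
Local Notation W := (galg gT K).
Local Notation V := (KL gT K).
Local Notation bar := (@galg_bar gT K s).
Local Notation mul := (KL_mul (K := K) s g0).
Local Notation gelt := (@gelt gT K).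
Local Notation gam := (gelt g0).
Local Notation KG := (KG gT K).
Local Notation trace a := (a + bar a).
Local Notation half := (2%:R^-1 : K).
Local Notation mulby x A := (linfun (loop_alg_mulr (K := K) (ra_mul s g0) x) @: A)%VS.
Implicit Types (a b c d f e : W) (A I F : {vspace V}).

Lemma lpair_mul0 a c : mul (lpair a 0) (lpair c 0) = lpair (a * c) 0.
Proof. by rewrite lpair_mul // !mulr0 !mul0r !addr0. Qed.

Lemma mem_mulby (x y : V) A : y \in mulby x A <-> exists2 z, z \in A & y = mul z x.
Proof.
split=> [/memv_imgP[z zA ->]|[z zA ->]]; first by exists z; rewrite // lfunE.
by apply/memv_imgP; exists z; rewrite // lfunE.
Qed.

(** * Central idempotents and Maschke averaging *)

Definition component e A : Prop :=
  [/\ galg_central e, e * e = e &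
      forall x, x \in A <-> exists2 a, a * e = a & x = lpair a 0].

(* Averaging a linear projection [p] onto an ideal gives an identity of it. *)
Lemma average_right (p : {linear W -> W}) a :
  a * (#|gT|%:R^-1 *: \sum_g gelt g^-1 * p (gelt g)) =
  #|gT|%:R^-1 *: \sum_g gelt g^-1 * p (gelt g * a).
Proof.
rewrite -scalerAr; congr (_ *: _).
elim/galg_ind: a => [|a b IHa IHb|k a IH|h].
- by rewrite mul0r big1 // => g _; rewrite mulr0 linear0 mulr0.
- rewrite mulrDl IHa IHb -big_split; apply: eq_bigr => g _ /=.
  by rewrite mulrDr raddfD mulrDr.
- rewrite -scalerAl IH scaler_sumr; apply: eq_bigr => g _.
  by rewrite -scalerAr linearZ -scalerAr.
(* Replacing g by gh cancels h on the left and moves it inside the projection. *)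
rewrite mulr_sumr [LHS](reindex_inj (mulIg h)); apply: eq_bigr => g _ /=.
by rewrite mulrA -!geltM invMg mulKVg.
Qed.

Lemma average_left (p : {linear W -> W}) a :
  (#|gT|%:R^-1 *: \sum_g p (gelt g) * gelt g^-1) * a =
  #|gT|%:R^-1 *: \sum_g p (a * gelt g) * gelt g^-1.
Proof.
rewrite -scalerAl; congr (_ *: _).
elim/galg_ind: a => [|a b IHa IHb|k a IH|h].
- by rewrite mulr0 big1 // => g _; rewrite mul0r linear0 mul0r.
- rewrite mulrDr IHa IHb -big_split; apply: eq_bigr => g _ /=.
  by rewrite mulrDl raddfD mulrDl.
- rewrite -scalerAr IH scaler_sumr; apply: eq_bigr => g _.
  by rewrite -scalerAl linearZ -scalerAl.
rewrite mulr_suml [LHS](reindex_inj (mulgI h)); apply: eq_bigr => g _ /=.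
by rewrite -mulrA -!geltM invMg mulgKV.
Qed.

(** A projection of vector spaces onto [I], with no compatibility with multiplication; the averaging
    supplies that. *)
Definition KG_proj I a : W := lfst (projv I (lpair a 0)).

Fact KG_proj_linear I : linear (KG_proj I).
Proof.
move=> k a b; rewrite /KG_proj.
have -> : lpair (k *: a + b) 0 = k *: lpair a 0 + lpair b 0 by rewrite lpairZ
  lpairD scaler0 addr0.
by rewrite linearP; apply/ffunP=> g; rewrite !ffunE.
Qed.

HB.instance Definition _ I :=
  GRing.isLinear.Build K W W _ (KG_proj I) (KG_proj_linear I).

(** One average is a right identity of [I], the other a left identity, so both equal one element e.
    It is central: ea and ae lie in [I], so ea = eae = ae. *)
Lemma ideal_component I : is_ideal mul KG I -> exists e, component e I.
Proof.
case=> sIKG idI.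
have inI a : lpair a 0 \in I -> KG_proj I a = a.
  by move=> aI; rewrite /KG_proj projv_id // lfstK.
have projI a : lpair (KG_proj I a) 0 \in I.
  have pI := memv_proj I (lpair a 0); rewrite /KG_proj.
  have /mem_KG[b eb] := subvP sIKG _ pI.
  by rewrite eb lfstK -eb.
have mkI a b : lpair a 0 \in I -> lpair (a * b) 0 \in I /\ lpair (b * a) 0 \in I.
  move=> aI; rewrite -!lpair_mul0; case: (idI (lpair b 0) (lpair a 0)) => //.
  by apply/mem_KG; exists b.
have sumI (f : gT -> W) : (forall g, lpair (f g) 0 \in I) -> lpair (#|gT|%:R^-1
  *: \sum_g f g) 0 \in I.
  move=> fI; have -> : lpair (#|gT|%:R^-1 *: \sum_g f g) 0 = #|gT|%:R^-1 *:
    \sum_g lpair (f g) 0.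
    by rewrite (lpair_sum _ _ f (fun=> 0)) big1_eq lpairZ scaler0.
  by rewrite memvZ // memv_suml.
pose er := #|gT|%:R^-1 *: \sum_g gelt g^-1 * KG_proj I (gelt g).
pose el := #|gT|%:R^-1 *: \sum_g KG_proj I (gelt g) * gelt g^-1.
have erI : lpair er 0 \in I by apply: sumI => g;
  case: (mkI _ (gelt g^-1) (projI (gelt g))).
have elI : lpair el 0 \in I by apply: sumI => g;
  case: (mkI _ (gelt g^-1) (projI (gelt g))).
have card_mean a : #|gT|%:R^-1 *: (\sum_(g : gT) a) = a.
  by rewrite sumr_const -scaler_nat scalerA mulVf ?scale1r.
have er_id a : lpair a 0 \in I -> a * er = a.
  move=> aI; rewrite average_right -[RHS]card_mean; congr (_ *: _);
    apply: eq_bigr => g _.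
  by rewrite /= inI ?mulrA -?geltM ?mulVg ?mul1r //; case: (mkI a (gelt g) aI).
have el_id a : lpair a 0 \in I -> el * a = a.
  move=> aI; rewrite average_left -[RHS]card_mean; congr (_ *: _);
    apply: eq_bigr => g _.
  by rewrite /= inI -?mulrA -?geltM ?mulgV ?mulr1 //; case: (mkI a (gelt g) aI).
have ee : el = er by rewrite -[LHS](er_id _ elI) (el_id _ erI).
rewrite ee in el_id; exists er; split.
- move=> a; have [h1 h2] := mkI _ a erI.
  by rewrite -[LHS](er_id _ h1) -mulrA el_id.
- exact: er_id.
move=> x; split=> [xI|[a <- ->]]; last by case: (mkI _ a erI).
have /mem_KG[a xa] := subvP sIKG _ xI.
by exists a; rewrite // er_id // -xa.
Qed.

(** * Simple components and the sign of s *)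

Section OneComponent.
Variables (e : W) (A : {vspace V}).
Hypothesis compA : component e A.

Let ce : galg_central e. Proof. by case: compA. Qed.
Let ee : e * e = e. Proof. by case: compA. Qed.

Lemma bar_comp : bar e = e. Proof. exact: (bar_central s_neq1 G_der). Qed.

Lemma compP x : x \in A <-> exists2 a, a * e = a & x = lpair a 0.
Proof. by case: compA. Qed.

Lemma mem_comp a : a * e = a -> lpair a 0 \in A.
Proof. by move=> ae; apply/compP; exists a. Qed.

Lemma mem_comp_e a : lpair (a * e) 0 \in A.
Proof. by apply: mem_comp; rewrite -mulrA ee. Qed.

Lemma mem_comp_inv a : lpair a 0 \in A -> a * e = a.
Proof. by case/compP=> b be /lpair_inj[-> _]. Qed.

Lemma compM a b : b * e = b -> a * b * e = a * b.
Proof. by rewrite -mulrA => ->. Qed.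

Lemma compMl a b : a * e = a -> a * b * e = a * b.
Proof. by move=> ae; rewrite -mulrA -ce mulrA ae. Qed.

Lemma comp_bar a : a * e = a -> bar a * e = bar a.
Proof. by move=> ae; rewrite -[in RHS]ae (barM G_mod_Z) // bar_comp ce. Qed.

Lemma comp_algebra : is_algebra mul A.
Proof.
by move=> x y /compP[a ae ->] /compP[b be ->]; rewrite lpair_mul0 mem_comp // compM.
Qed.

Lemma comp_associative : is_associative mul A.
Proof.
move=> x y z /compP[a ae ->] /compP[b be ->] /compP[c ec ->].
by rewrite !lpair_mul0 mulrA.
Qed.

Lemma comp_identity : is_identity mul A (lpair e 0).
Proof.
split; first exact: mem_comp.
by move=> x /compP[a ae ->]; rewrite !lpair_mul0 ce ae.
Qed.

Lemma comp_mulby_ideal c : galg_central c -> is_ideal mul A (mulby (lpair c 0) A).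
Proof.
move=> cc; split=> [|x y].
  apply/subvP=> y /mem_mulby[z /compP[a ae ->] ->].
  by rewrite lpair_mul0 mem_comp // compMl.
move=> /compP[a ae ->] /mem_mulby[z /compP[b be ->] ->]; rewrite !lpair_mul0.
split; apply/mem_mulby.
  by exists (lpair (a * b) 0); rewrite ?mem_comp ?compM // lpair_mul0 mulrA.
by exists (lpair (b * a) 0); rewrite ?mem_comp ?compM // lpair_mul0 -!mulrA cc.
Qed.

Hypothesis simpleA : is_simple mul A.

Lemma comp_neq0 : e != 0.
Proof.
apply/eqP=> e0; case: simpleA => _ [x [y [/compP[a ae ->] _]]].
by rewrite -ae e0 mulr0 lpair0 KL_mul0l eqxx.
Qed.

(** The ideal [A c] contains c, so simplicity makes it all of [A], and e = dc for some d. *)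
Lemma central_inv c : galg_central c -> c * e = c -> c != 0 ->
  exists d, [/\ galg_central d, d * e = d & d * c = e].
Proof.
move=> cc cce c0; case: simpleA => _ _ /(_ _ (comp_mulby_ideal cc))[I0|IA].
  case/eqP: c0; have : lpair c 0 \in mulby (lpair c 0) A.
    by apply/mem_mulby; exists (lpair e 0); rewrite ?mem_comp // lpair_mul0 ce cce.
  by rewrite I0 memv0 => /eqP/lpair_eq0[].
have : lpair e 0 \in mulby (lpair c 0) A by rewrite IA mem_comp.
case/mem_mulby => _ /compP[d de ->]; rewrite lpair_mul0 => /lpair_inj[/esym dc _].
exists d; split=> // b.
(* db = dbe = db(cd) = (dc)bd = bd. *)
rewrite -(compMl b de) -{1}dc -cc !mulrA -[d * b * c]mulrA -[b * c]cc mulrA dc.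
by rewrite ce -mulrA ce de.
Qed.

Lemma gelt_s_central : galg_central (gelt s).
Proof. by apply/galg_central_gelt/s_central. Qed.

Lemma gelt_s_sq : gelt s * gelt s = 1.
Proof. by rewrite -geltM (s_sq s_neq1 G_der). Qed.

(** For t = se one has tt = e, so (e - t)(e + t) = 0; if e + t is nonzero, it is invertible by
    [central_inv], and t = e. *)
Lemma comp_sign : gelt s * e = e \/ gelt s * e = - e.
Proof.
set t := gelt s * e; have ct : galg_central t.
  by apply: galg_centralM => //; apply: gelt_s_central.
have te : t * e = t by rewrite /t -mulrA ee.
have tt : t * t = e by rewrite {2}/t mulrA ct -mulrA te /t mulrA gelt_s_sq mul1r.
have [/eqP|p0] := eqVneq (e + t) 0.
  by rewrite addrC addr_eq0 => /eqP; right.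
have [|| d [cd de dp]] := @central_inv (e + t) _ _ p0; first exact: galg_centralD.
  by rewrite mulrDl ee te.
left; apply/esym/eqP; rewrite -subr_eq0.
have -> : e - t = (e - t) * e by rewrite mulrBl ee te.
by rewrite -[X in _ * X]dp mulrA -cd -mulrA mulrDr !mulrBl ee ce te tt addrA
  subrK subrr mulr0.
Qed.

Lemma half_half a : half *: a + half *: a = a.
Proof. by rewrite -scalerDl -mulr2n -[half *+ 2]mulr_natl mulfV // scale1r. Qed.

(** The relation gh = s hg becomes ghe = hge. *)
Lemma plus_central a : gelt s * e = e -> a * e = a -> galg_central a.
Proof.
move=> se ae b; rewrite -(compMl b ae) -[in RHS]ae mulrA {ae}.
elim/galg_ind: a => [|a a' IH IH'|k a IH|g]; first by rewrite mul0r mulr0.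
- by rewrite mulrDl mulrDr !mulrDl IH IH'.
- by rewrite -scalerAl -scalerAr -!scalerAl IH.
elim/galg_ind: b => [|b b' IH IH'|k b IH|h]; first by rewrite mul0r mulr0.
- by rewrite mulrDl mulrDr !mulrDl IH IH'.
- by rewrite -scalerAl -scalerAr -!scalerAl IH.
rewrite -!geltM; have [-> //|->] := commute_or_s s_neq1 G_der g h.
by rewrite geltM gelt_s_central -mulrA se.
Qed.

Lemma plus_bar a : gelt s * e = e -> a * e = a -> bar a = a.
Proof. by move=> se ae; apply: (bar_central s_neq1 G_der); apply: plus_central. Qed.

Lemma plus_field : gelt s * e = e -> is_field mul A.
Proof.
move=> se; split; [exact: comp_algebra | exact: comp_associative | |].
  move=> x y /compP[a ae ->] /compP[b be ->].
  by rewrite !lpair_mul0 (plus_central se ae).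
exists (lpair e 0); split; first exact: comp_identity.
  by apply: contra_neq comp_neq0 => /lpair_eq0[].
move=> x /compP[a ae ->] a0; have ca := plus_central se ae.
have [|d [cd de da]] := central_inv ca ae.
  by apply: contra_neq a0 => ->; rewrite lpair0.
by exists (lpair d 0); rewrite ?mem_comp // lpair_mul0 ca da.
Qed.

(* z is the trace of z/2 when z is central. *)
Definition centerF : {vspace V} := (linfun (KL_trace (K := K) s) @: A)%VS.

Lemma mem_centerF x :
  x \in centerF <-> exists f, [/\ galg_central f, f * e = f & x = lpair f 0].
Proof.
split=> [/memv_imgP[_ /compP[a ae ->] ->]|[f [cf fe ->]]].
  rewrite lfunE /= /KL_trace lfstK; exists (a + bar a); split=> //.
    exact: trace_central.
  by rewrite mulrDl ae comp_bar.
apply/memv_imgP; exists (lpair (half *: f) 0);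
  first by rewrite mem_comp // -scalerAl fe.
by rewrite lfunE /= /KL_trace lfstK linearZ /= (bar_central s_neq1 G_der) ?half_half.
Qed.

Lemma mem_centerF_central z : z \in centerF <-> central mul A z.
Proof.
split=> [/mem_centerF[f [cf fe ->]]|[/compP[f fe ->] comm _]].
  split; first exact: mem_comp.
    by move=> x /compP[a ae ->]; rewrite !lpair_mul0 cf.
  move=> x y /compP[a ae ->] /compP[b be ->]; rewrite !lpair_mul0 !mulrA.
  by split; rewrite // -?mulrA -?cf ?mulrA // -cf.
apply/mem_centerF; exists f; split=> // b.
have := comm _ (mem_comp_e b); rewrite !lpair_mul0 => /lpair_inj[+ _].
by rewrite mulrA (compMl b fe) -mulrA ce fe.
Qed.

Lemma centerF_field : is_field mul centerF.
Proof.
have FA x : x \in centerF -> x \in A by case/mem_centerF=> f [_ fe ->]; apply: mem_comp.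
split.
- move=> _ _ /mem_centerF[f [cf fe ->]] /mem_centerF[f' [cf' fe' ->]].
  rewrite lpair_mul0; apply/mem_centerF; exists (f * f'); split=> //; last exact: compM.
  exact: galg_centralM.
- by move=> x y z /FA xA /FA yA /FA zA; apply: comp_associative.
- move=> _ _ /mem_centerF[f [cf fe ->]] /mem_centerF[f' [cf' fe' ->]].
  by rewrite !lpair_mul0 cf.
exists (lpair e 0); split; first split.
- by apply/mem_centerF; exists e.
- by move=> x /FA xA; apply: comp_identity.2.
- by apply: contra_neq comp_neq0 => /lpair_eq0[].
move=> _ /mem_centerF[f [cf fe ->]] f0.
have [|d [cd de da]] := central_inv cf fe.
  by apply: contra_neq f0 => ->; rewrite lpair0.
exists (lpair d 0); last by rewrite lpair_mul0 cf da.
by apply/mem_centerF; exists d.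
Qed.

(** * Coordinates over the centre when s acts as -1 *)

Definition crep (i : 'I_#|([set: gT] / Z)%g|) : gT := repr (enum_val i).

Lemma crep_central i j : ((crep i * (crep j)^-1)%g \in Z) = (i == j).
Proof.
rewrite -coset_eq1 cosetM cosetV -eq_mulgV1 /crep !coset_reprK.
exact: (inj_eq enum_val_inj).
Qed.

Lemma crep_exists g : exists i, (g * (crep i)^-1)%g \in Z.
Proof.
exists (enum_rank_in (coset_in_quotient g) (coset Z g)).
rewrite -coset_eq1 cosetM cosetV -eq_mulgV1 /crep coset_reprK enum_rankK_in //.
exact: coset_in_quotient.
Qed.

(** A noncentral g has trace g + sg, which vanishes after multiplication by e. Thus the half-trace
    extracts the part supported on the centre of the group. *)
Lemma minus_trace g : gelt s * e = - e ->
  half *: trace (gelt g) * e = if g \in Z then gelt g * e else 0.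
Proof.
move=> se; rewrite bar_gelt // /ra_star; case: ifP => _.
  by rewrite scalerDr half_half.
rewrite -scalerAl mulrDl geltM gelt_s_central -mulrA se mulrN subrr scaler0.
by [].
Qed.

(* When s acts as -1, [crep i] and the halves of their inverses are dual bases
   for the trace form, so these are the coordinates of [a * e]. *)
Definition rep_coef (i : 'I_#|([set: gT] / Z)%g|) a : W :=
  half *: trace (a * gelt (crep i)^-1) * e.

Lemma rep_coefD i a b : rep_coef i (a + b) = rep_coef i a + rep_coef i b.
Proof. by rewrite /rep_coef mulrDl [bar (_ + _)]raddfD /= addrACA scalerDr mulrDl. Qed.

Lemma rep_coefZ i k a : rep_coef i (k *: a) = k *: rep_coef i a.
Proof. by rewrite /rep_coef -[k *: a * _]scalerAl [bar (_ *: _)]linearZ /=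
  -scalerDr scalerA mulrC -scalerA -scalerAl. Qed.

Lemma rep_coef0 i : rep_coef i 0 = 0.
Proof. by have := rep_coefZ i 0 0; rewrite !scale0r. Qed.

Lemma rep_coefM i f a : galg_central f -> rep_coef i (f * a) = f * rep_coef i a.
Proof.
move=> cf; rewrite /rep_coef -[f * a * _]mulrA [bar (f * _)](barM G_mod_Z) //.
by rewrite [bar f](bar_central s_neq1 G_der) // -cf -mulrDr scalerAr mulrA.
Qed.

Lemma rep_coef_central i a : galg_central (rep_coef i a).
Proof.
apply: galg_centralM => //; apply: galg_centralZ; exact: trace_central.
Qed.

Lemma rep_coefe i a : rep_coef i a * e = rep_coef i a.
Proof. by rewrite /rep_coef -mulrA ee. Qed.

Lemma rep_expand a : gelt s * e = - e ->
  a * e = \sum_i rep_coef i a * (gelt (crep i) * e).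
Proof.
move=> se; elim/galg_ind: a => [|a a' IH IH'|k a IH|g].
- by rewrite mul0r big1 // => i _; rewrite rep_coef0 mul0r.
- rewrite mulrDl IH IH' -big_split; apply: eq_bigr => i _ /=.
  by rewrite rep_coefD mulrDl.
- rewrite -scalerAl IH scaler_sumr; apply: eq_bigr => i _.
  by rewrite rep_coefZ scalerAl.
(* Only the coset of g contributes, with coefficient g [crep i]^-1 e. *)
have [i gi] := crep_exists g; rewrite (bigD1 i) //= big1 => [|j ji].
  by rewrite addr0 /rep_coef -geltM minus_trace // gi -mulrA [e * _]mulrA ce
    -mulrA ee mulrA -geltM mulgKV.
rewrite /rep_coef -geltM minus_trace // ifN ?mul0r //.
apply: contra ji => gj; rewrite -crep_central.
rewrite -[(crep j * _)%g]mul1g -(mulVg (g * (crep j)^-1)%g) -mulgA.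
by rewrite groupM ?groupV // mulgA mulgKV.
Qed.

Lemma rep_coef_rep i j : gelt s * e = - e -> rep_coef j (gelt (crep i)) = if i ==
  j then e else 0.
Proof.
move=> se; rewrite /rep_coef -geltM minus_trace // crep_central.
by case: eqP => // ->; rewrite mulgV mul1r.
Qed.

Lemma minus_dim : gelt s * e = - e -> has_dim_over mul centerF A 4.
Proof.
move=> se; rewrite -(card_G_mod_Z G_mod_Z).
exists (fun i => lpair (gelt (crep i) * e) 0); split=> [i|]; first exact: mem_comp_e.
move=> x /compP[a ae ->]; exists [ffun i => lpair (rep_coef i a) 0]; split.
  split=> [i|].
    rewrite ffunE; apply/mem_centerF; exists (rep_coef i a).
    by split; rewrite ?rep_coefe //; apply: rep_coef_central.
  under eq_bigr do rewrite ffunE lpair_mul0.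
  by rewrite (lpair_sum _ _ _ (fun=> 0)) big1_eq -rep_expand // ae.
move=> c [cF ec]; apply/ffunP=> j; rewrite ffunE.
pose f i := lfst (c i).
have cE i : [/\ galg_central (f i), f i * e = f i & c i = lpair (f i) 0].
  by have /mem_centerF[d [cd de cid]] := cF i; rewrite /f cid lfstK.
have -> : a = \sum_i f i * gelt (crep i).
  move: ec; under eq_bigr => i _.
    have [cfi fie ->] := cE i; rewrite lpair_mul0 -ce mulrA fie; over.
  by rewrite (lpair_sum _ _ _ (fun=> 0)) => /lpair_inj[].
have [cfj fje ->] := cE j; congr lpair.
(* Uniqueness by duality: the j-th coordinate of the sum retains [f j] alone. *)
rewrite (big_morph _ (rep_coefD j) (rep_coef0 j)) (bigD1 j) //= big1 => [|i ij].
  by rewrite rep_coefM // rep_coef_rep // eqxx fje addr0.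
have [cfi fie _] := cE i.
by rewrite rep_coefM // rep_coef_rep // (negPf ij) mulr0.
Qed.

Lemma minus_quaternion : gelt s * e = - e -> is_quaternion_over mul centerF A.
Proof.
move=> se; split; split=> //.
- exact: comp_associative.
- by exists (lpair e 0); apply: comp_identity.
- exact: mem_centerF_central.
- exact: centerF_field.
- exact: minus_dim.
Qed.

(** * The double of a component *)

Local Notation B := (A + times_u s g0 A)%VS.
Local Notation u := (lpair 0 1 : V).

Lemma mul_u a : mul (lpair a 0) u = lpair 0 a.
Proof. by rewrite lpair_mul // !mulr0 !mul0r !addr0 mul1r. Qed.

Lemma lpair_mull0 a c d : mul (lpair a 0) (lpair c d) = lpair (a * c) (d * a).
Proof. by rewrite lpair_mul // !mulr0 !mul0r !addr0. Qed.

Lemma lpair_mulr0 a b c : mul (lpair a b) (lpair c 0) = lpair (a * c) (b * bar c).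
Proof. by rewrite lpair_mul // linear0 mulr0 !mul0r addr0 add0r. Qed.

Lemma mem_times_u x : x \in times_u s g0 A <-> exists2 b, b * e = b & x = lpair 0 b.
Proof.
rewrite /times_u -[basis_elt K _]lpair_inr gelt1.
split=> [/mem_mulby[_ /compP[b be ->] ->]|[b be ->]]; first by exists b; rewrite ?mul_u.
by apply/mem_mulby; exists (lpair b 0); rewrite ?mem_comp ?mul_u.
Qed.

Lemma mem_doubleP x : x \in B <-> exists a b, [/\ a * e = a, b * e = b & x = lpair a b].
Proof.
split=> [/memv_addP[_ /compP[a ae ->] [_ /mem_times_u[b be ->] ->]]|[a [b [ae be ->]]]].
  by exists a, b; rewrite lpairD addr0 add0r.
apply/memv_addP; exists (lpair a 0); first exact: mem_comp.
by exists (lpair 0 b); [apply/mem_times_u; exists b | rewrite lpairD addr0 add0r].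
Qed.

Lemma mem_double a b : a * e = a -> b * e = b -> lpair a b \in B.
Proof. by move=> ae be; apply/mem_doubleP; exists a, b. Qed.

Lemma subv_double : (A <= B)%VS. Proof. exact: addvSl. Qed.

Lemma double_algebra : is_algebra mul B.
Proof.
move=> x y /mem_doubleP[a [b [ae be ->]]] /mem_doubleP[c [d [ec de ->]]].
rewrite lpair_mul //; apply: mem_double; rewrite mulrDl.
  by rewrite !compM.
by rewrite !compM // comp_bar.
Qed.

Lemma double_identity : is_identity mul B (lpair e 0).
Proof.
split; first by apply: mem_double; rewrite ?mul0r.
move=> x /mem_doubleP[a [b [ae be ->]]];
  rewrite !lpair_mul // linear0 bar_comp ce ae be.
by rewrite !mulr0 !mul0r !addr0 add0r.
Qed.

(** * Cayley algebras: s acts as -1 *)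

Section Minus.
Hypothesis se : gelt s * e = - e.

Local Notation nrm := (galg_norm s).
Definition KL_norm (x : V) : V := lpair (nrm (lfst x) - gam * nrm (lsnd x)) 0.

Lemma gam_central : galg_central gam. Proof. exact: galg_central_gelt. Qed.
Lemma KL_normE a b : KL_norm (lpair a b) = lpair (nrm a - gam * nrm b) 0.
Proof. by rewrite /KL_norm lfstK lsndK. Qed.

Lemma KL_polE a b c d :
  KL_norm (lpair a b + lpair c d) - KL_norm (lpair a b) - KL_norm (lpair c d) =
  lpair (trace (a * bar c) - gam * trace (b * bar d)) 0.
Proof.
have nrmD p q : nrm (p + q) = nrm p + nrm q + trace (p * bar q).
  rewrite /galg_norm raddfD /= mulrDl !mulrDr [q * _ + _]addrC addrACA.
  by rewrite (barM G_mod_Z) // (barK s_neq1 G_der).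
rewrite lpairD !KL_normE !lpairB !subr0; congr lpair.
rewrite !nrmD [gam * (_ + trace _)]mulrDr [gam * (nrm b + _)]mulrDr.
exact: zmod_polar_eq.
Qed.

(** The coordinates of a are half-traces of a times elements of the component, so all of them
    vanish. *)
Lemma trace_nondeg a : a * e = a ->
  (forall c, c * e = c -> trace (a * c) = 0) -> a = 0.
Proof.
move=> ae tr0; rewrite -ae rep_expand // big1 // => i _.
rewrite /rep_coef.
have -> : a * gelt (crep i)^-1 = a * (gelt (crep i)^-1 * e).
  by rewrite mulrA compMl.
by rewrite tr0 ?scaler0 ?mul0r // -mulrA ee.
Qed.

Lemma KL_normM a b c d :
  KL_norm (mul (lpair a b) (lpair c d)) = mul (KL_norm (lpair a b)) (KL_norm
    (lpair c d)).
Proof.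
rewrite lpair_mul // !KL_normE lpair_mul0; congr lpair.
by apply: (galg_norm_mul G_mod_Z) => //; apply: gam_central.
Qed.

Lemma gam_cancel a : gam * a = 0 -> a = 0.
Proof.
by move/(congr1 ( *%R (gelt g0^-1))); rewrite mulrA -geltM mulVg mul1r mulr0.
Qed.

(** Products with bu may apply bar to f; since bar fixes central elements, f still passes
    through. *)
Lemma double_central z : z \in centerF -> central mul B z.
Proof.
case/mem_centerF=> f [cf fe ->];
  have bf : bar f = f by apply: (bar_central s_neq1 G_der).
have cfM p q : p * f * q = p * q * f by rewrite -mulrA cf mulrA.
split; first exact: (subvP subv_double _ (mem_comp fe)).
  by move=> _ /mem_doubleP[a [b [_ _ ->]]]; rewrite lpair_mull0 lpair_mulr0 bf cf.
move=> _ _ /mem_doubleP[a [b [_ _ ->]]] /mem_doubleP[c [d [_ _ ->]]].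
rewrite !lpair_mull0 !lpair_mulr0 [mul (lpair a b) (lpair c d)]lpair_mul //
  lpair_mull0 lpair_mulr0 !lpair_mul // bf.
rewrite [bar (f * c)](barM G_mod_Z) // [bar (d * f)](barM G_mod_Z) // [bar (c *
  f)](barM G_mod_Z) // !bf.
rewrite !mulrDl !mulrDr !mulrA !(cfM, cf).
by split.
Qed.

Lemma double_composition : is_composition_over mul centerF B.
Proof.
have FA x : x \in centerF -> x \in A by case/mem_centerF=> f [_ fe ->]; apply: mem_comp.
split; first split.
- exact: double_algebra.
- exact: centerF_field.
- exact: double_central.
- exists (lpair e 0); first exact: double_identity.
  by apply/mem_centerF; exists e.
exists KL_norm; split.
- move=> _ /mem_doubleP[a [b [ae be ->]]]; rewrite KL_normE; apply/mem_centerF.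
  exists (nrm a - gam * nrm b); split=> //.
    apply: galg_centralB; first exact: norm_central.
    by apply: galg_centralM; [exact: gam_central | exact: norm_central].
  by rewrite mulrBl !compM // comp_bar.
- move=> _ _ /mem_centerF[f [cf fe ->]] /mem_doubleP[a [b [ae be ->]]].
  have bf : bar f = f by apply: (bar_central s_neq1 G_der).
  have nf p : nrm (f * p) = f * f * nrm p.
    by rewrite /galg_norm (barM G_mod_Z) // bf -cf !mulrA -[f * p * f]mulrA -[p *
      f]cf mulrA.
  rewrite lpair_mul0 lpair_mull0 !KL_normE !lpair_mul0.
  rewrite -[b * f]cf !nf; congr lpair; rewrite mulrBr; congr (_ - _).
  by rewrite mulrA [RHS]mulrA (gam_central (f * f)).
- split.
    move=> _ _ _ /mem_doubleP[a [b [_ _ ->]]] /mem_doubleP[c [d [_ _ ->]]]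
      /mem_doubleP[p [q [_ _ ->]]].
    rewrite (lpairD a b c d); apply: etrans (KL_polE (a + c) (b + d) p q) _.
    apply: etrans (esym (congr2 +%R (KL_polE a b p q) (KL_polE c d p q))).
    rewrite lpairD addr0; congr lpair.
    rewrite !mulrDl !raddfD /= ![_ + _ + (bar _ + bar _)]addrACA mulrDr opprD.
    exact: addrACA.
  move=> _ _ _ /mem_centerF[f [cf fe ->]] /mem_doubleP[a [b [_ _ ->]]]
    /mem_doubleP[c [d [_ _ ->]]].
  have bf : bar f = f by apply: (bar_central s_neq1 G_der).
  have trf p : trace (f * p) = f * trace p by rewrite (barM G_mod_Z) // bf -cf mulrDr.
  rewrite lpair_mull0; apply: etrans (KL_polE (f * a) (b * f) c d) _.
  apply: etrans (esym (congr1 (mul (lpair f 0)) (KL_polE a b c d))).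
  rewrite lpair_mul0; congr lpair.
  rewrite -[b * f]cf -!mulrA !trf mulrBr; congr (_ - _).
  by rewrite mulrA gam_central -mulrA.
- move=> _ /mem_doubleP[a [b [ae be ->]]] pol0.
  (* Testing against bar(p) + bar(q)u undoes the bars in the polar form; q = 0 and p = 0 then
     separate the two traces. *)
  have pol p q : p * e = p -> q * e = q -> trace (a * p) - gam * trace (b * q) = 0.
    move=> pe qe; have bpq : lpair (bar p) (bar q) \in B by rewrite mem_double
      ?comp_bar.
    have := pol0 _ bpq; rewrite KL_polE !(barK s_neq1 G_der).
    by case/lpair_eq0.
  have -> : a = 0.
    apply: trace_nondeg => // p pe; have := pol p 0 pe (mul0r _).
    by rewrite mulr0 linear0 addr0 mulr0 subr0.
  have -> : b = 0; last exact: lpair0.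
  apply: trace_nondeg => // q qe; have := pol 0 q (mul0r _) qe.
  by rewrite mulr0 linear0 addr0 sub0r => /eqP; rewrite oppr_eq0 => /eqP/gam_cancel.
move=> _ _ /mem_doubleP[a [b [_ _ ->]]] /mem_doubleP[c [d [_ _ ->]]]; exact: KL_normM.
Qed.

Lemma double_dim (n : nat) : has_dim_over mul centerF A n -> has_dim_over mul
  centerF B (n + n).
Proof.
case=> b [bA bP].
(* On [A] this is x |-> xu; a basis b of [A] is completed by the elements bu. *)
pose J x : V := lpair 0 (lfst x).
have JA x : x \in A -> J x \in B.
  by case/compP=> a ae ->; rewrite /J lfstK mem_double ?mul0r.
have mulJ (f x : V) : f \in centerF -> x \in A -> mul f (J x) = J (mul f x).
  case/mem_centerF=> p [cp pe ->] /compP[a ae ->].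
  by rewrite /J lfstK lpair_mul0 lfstK lpair_mull0 mulr0 cp.
have sumJ (X : 'I_n -> V) : \sum_i J (X i) = J (\sum_i X i).
  elim/big_rec2: _ => [|i x y _ ->]; first by rewrite /J; apply/ffunP=> -[g|g];
    rewrite !ffunE.
  by rewrite /J lpairD addr0; congr lpair; apply/ffunP=> g; rewrite !ffunE.
have expand (c : 'I_(n + n) -> V) : (forall i, c i \in centerF) ->
    \sum_i mul (c i) (match split i with inl i => b i | inr i => J (b i) end) =
    \sum_i mul (c (lshift n i)) (b i) + J (\sum_i mul (c (rshift n i)) (b i)).
  move=> cF; rewrite big_split_ord -sumJ; congr (_ + _); apply: eq_bigr => i _.
    by case: split_ordP => j /eqP; rewrite ?eq_shift // => /eqP->.
  by case: split_ordP => j /eqP; rewrite ?eq_shift // => /eqP->; rewrite mulJ.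
have sumA (c : 'I_n -> V) : (forall i, c i \in centerF) -> \sum_i mul (c i) (b i) \in A.
  move=> cF; apply: memv_suml => i _; apply: comp_algebra => //.
  by have /mem_centerF[f [_ fe ->]] := cF i; apply: mem_comp.
exists (fun i => match split i with inl i => b i | inr i => J (b i) end); split.
  by move=> i; case: split => j; [exact: (subvP subv_double) | exact: JA].
move=> _ /mem_doubleP[p [q [pe qe ->]]].
have [cp [[cpF ep] up]] := bP _ (mem_comp pe);
  have [cq [[cqF eq] uq]] := bP _ (mem_comp qe).
have lpairJ x y : lpair x y = lpair x 0 + J (lpair y 0) by rewrite /J lfstK
  lpairD addr0 add0r.
exists [ffun i => match split i with inl i => cp i | inr i => cq i end]; split.
  have cF i : [ffun i => match split i with inl i => cp i | inr i => cq i end] i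
    \in centerF.
    by rewrite ffunE; case: split.
  split=> //; rewrite expand // lpairJ ep eq; congr (_ + J _);
    apply: eq_bigr => i _; rewrite ffunE.
    by case: split_ordP => j /eqP; rewrite ?eq_shift // => /eqP->.
  by case: split_ordP => j /eqP; rewrite ?eq_shift // => /eqP->.
(* Comparing the two entries of the pair, the halves of c are coordinate families of p and q, which
   are unique. *)
move=> c [cF]; rewrite expand //.
have /compP[x xe ex] := sumA (fun i => c (lshift n i)) (fun i => cF _).
have /compP[y ye ey] := sumA (fun i => c (rshift n i)) (fun i => cF _).
rewrite ex ey -lpairJ => /lpair_inj[px qy].
apply/ffunP=> i; rewrite ffunE; case: split_ordP => j ->.
  rewrite (up [ffun i => c (lshift n i)]) ?ffunE //; split=> [k|];
    first by rewrite ffunE.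
  by rewrite px -ex; apply: eq_bigr => k _; rewrite ffunE.
rewrite (uq [ffun i => c (rshift n i)]) ?ffunE //; split=> [k|]; first by rewrite ffunE.
by rewrite qy -ey; apply: eq_bigr => k _; rewrite ffunE.
Qed.

Lemma double_Cayley_Dickson : is_Cayley_Dickson_double mul centerF A B.
Proof.
have mulv a : a * e = a -> mul (lpair a 0) (lpair 0 e) = lpair 0 a.
  by move=> ae; rewrite lpair_mull0 mulr0 ce ae.
(* u itself need not lie in [B]; its component eu does, and (eu)(eu) = g0 e. *)
exists (fun x => lpair (bar (lfst x)) 0), (lpair (gam * e) 0), (lpair 0 e); split.
- split; first exact: subv_double.
  by exists (lpair e 0); [exact: double_identity | exact: mem_comp].
- split.
  + move=> _ /compP[a ae ->]; rewrite !lfstK (barK s_neq1 G_der).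
    by rewrite mem_comp // comp_bar.
  + move=> _ _ /compP[a ae ->] /compP[b be ->].
    by rewrite lpairD !lfstK lpairD raddfD addr0.
  + move=> _ _ /mem_centerF[f [cf fe ->]] /compP[a ae ->].
    rewrite lpair_mul0 !lfstK lpair_mul0 (barM G_mod_Z) //.
    by rewrite [bar f](bar_central s_neq1 G_der) // cf.
  + move=> _ _ /compP[a ae ->] /compP[b be ->].
    by rewrite lpair_mul0 !lfstK lpair_mul0 (barM G_mod_Z).
  + move=> _ /compP[a ae ->]; rewrite lfstK lpairD addr0 lpair_mul0.
    split; apply/mem_centerF.
      exists (trace a); split=> //; first exact: trace_central.
      by rewrite mulrDl ae comp_bar.
    exists (nrm a); split=> //; first exact: norm_central.
    by rewrite compM // comp_bar.
- split.
  + apply/mem_centerF; exists (gam * e); split=> //; last by rewrite -mulrA ee.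
    by apply: galg_centralM => //; apply: gam_central.
  + by apply: contra_neq comp_neq0 => /lpair_eq0[/gam_cancel].
  + by rewrite mem_double ?mul0r.
- move=> _ /mem_doubleP[a [b [ae be ->]]]; exists (lpair a 0, lpair b 0); split=> /=.
    by rewrite !mem_comp // mulv // lpairD addr0 add0r.
  move=> [_ _] /= [/compP[p pe ->] /compP[q qe ->]].
  by rewrite mulv // lpairD addr0 add0r => /lpair_inj[-> ->].
move=> _ _ /compP[a ae ->] /compP[b be ->]; rewrite !lfstK.
rewrite !lpair_mul0 !mulv ?compM ?comp_bar //.
rewrite !lpair_mull0 lpair_mulr0 lpair_mul // !(mul0r, mulr0) !add0r.
by rewrite linear0 mulr0 -[gam * e * _]mulrA (ce (bar b * a)) -[bar b * a *
  e]mulrA ae mulrA.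
Qed.

Lemma double_Cayley : is_Cayley mul B.
Proof.
exists centerF; split; first exact: double_composition.
- exact: (double_dim (minus_dim se)).
- exists A; [exact: minus_quaternion | exact: double_Cayley_Dickson].
Qed.

End Minus.

(** Noncommuting g and h satisfy gh = s hg, so ge and he anticommute. *)
Lemma minus_noncommutative : gelt s * e = - e -> ~~ abelian [set: gT] ->
  ~ is_commutative mul A.
Proof.
move=> se /negP nab cA; apply: nab; apply/centsP=> g _ h _.
have [//|gh] := commute_or_s s_neq1 G_der g h.
have := cA _ _ (mem_comp_e (gelt g)) (mem_comp_e (gelt h));
  rewrite !lpair_mul0 => /lpair_inj[+ _].
have geM x y : gelt x * e * (gelt y * e) = gelt (x * y) * e.
  by rewrite -mulrA [e * _]mulrA ce -mulrA ee mulrA geltM.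
rewrite !geM gh geltM gelt_s_central -mulrA se mulrN => /eqP.
rewrite eq_sym -addr_eq0 -mulr2n -scaler_nat scaler_eq0 (negPf two_neq0) /=.
move/eqP/(congr1 ( *%R (gelt (h * g)^-1))); rewrite mulrA -geltM mulVg mul1r mulr0.
by move/eqP; rewrite (negPf comp_neq0).
Qed.

(** * Quadratic extensions of fields: s acts as 1 *)

Section Plus.
Hypothesis se : gelt s * e = e.

Let cp a : a * e = a -> galg_central a. Proof. exact: plus_central. Qed.

(** With bar trivial this is the product of the quadratic algebra [A[u]] in which u squares to g0
    e. *)
Lemma plus_mul a b c d : a * e = a -> b * e = b -> c * e = c -> d * e = d ->
  mul (lpair a b) (lpair c d) = lpair (a * c + gam * d * b) (d * a + b * c).
Proof. by move=> ae be ec de; rewrite lpair_mul // !plus_bar. Qed.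

Lemma plus_double_commutative : is_commutative mul B.
Proof.
move=> _ _ /mem_doubleP[a [b [ae be ->]]] /mem_doubleP[c [d [ec de ->]]].
by rewrite !plus_mul // (cp ae c) -!mulrA (cp de b) [d * a + _]addrC.
Qed.

Lemma plus_double_associative : is_associative mul B.
Proof.
move=> _ _ _ /mem_doubleP[a [b [ae be ->]]] /mem_doubleP[c [d [ec de ->]]]
  /mem_doubleP[p [q [pe qe ->]]].
rewrite !plus_mul // ?mulrDl ?compM // !mulrDr !mulrDl !mulrA.
have push x y z : x * e = x -> y * x * z = y * z * x.
  by move=> xe; rewrite -mulrA (cp xe) mulrA.
have addP x y z w : x + y + (z + w) = x + w + (y + z) :> W.
  by rewrite [z + w]addrC addrACA.
congr lpair.
  rewrite (push c (gam * q) b ec) (push p (gam * d) b pe).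
  have -> : a * gam * q * d = gam * q * d * a by rewrite -!mulrA (cp ae) !mulrA.
  exact: addP.
rewrite (push c q a ec) (push p d a pe).
have -> : b * gam * q * d = q * gam * d * b.
  by rewrite -!mulrA (cp be) !mulrA (gam_central q).
exact: addP.
Qed.

(** The inverse of a + bu is (a - bu)/c with c = aa - g0 bb. If c = 0 and a is nonzero, b/a
    contradicts the hypothesis; if c = 0 and a = 0, then bb = 0, so b = 0 as well. *)
Lemma plus_double_field :
  ~ (exists t, t * e = t /\ gam * t * t = e) -> is_field mul B.
Proof.
move=> nonsq; split; [exact: double_algebra | exact: plus_double_associative |
                      exact: plus_double_commutative |].
exists (lpair e 0); split; first exact: double_identity.
  by apply: contra_neq comp_neq0 => /lpair_eq0[].
move=> _ /mem_doubleP[a [b [ae be ->]]] ab0.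
have cg := gam_central.
pose c := a * a - gam * b * b.
have cce : c * e = c by rewrite mulrBl !compM.
have [c0|c0] := eqVneq c 0.
  have e1 : a * a = gam * b * b by apply/eqP; rewrite -subr_eq0 -/c c0.
  have [a0|a0] := eqVneq a 0.
    have b0 : b != 0 by apply: contra_neq ab0 => ->; rewrite a0 lpair0.
    have [d [cd de db]] := central_inv (cp be) be b0.
    move: e1; rewrite a0 mul0r -mulrA => /esym/gam_cancel bb0.
    by case/eqP: b0; rewrite -[LHS]be -[X in _ * X]db (cd b) mulrA bb0 mul0r.
  have [d [cd de da]] := central_inv (cp ae) ae a0.
  case: nonsq; exists (b * d); split; first exact: compM.
  rewrite -!mulrA (galg_mulCA d _ (cp be)) !mulrA -e1 -!mulrA [a * (d * d)]mulrA.
  by rewrite -[a * d]cd da ce de -cd da.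
have [d [cd de dc]] := central_inv (cp cce) cce c0.
exists (lpair (a * d) (- (b * d))); first by rewrite mem_double ?mulNr ?compM.
rewrite plus_mul // ?mulNr ?compM // mulrN mulNr -dc cd mulrBl !mulrA.
congr lpair.
  by rewrite -[gam * b * d * b]mulrA (cd b) mulrA.
by rewrite -[b * d * a]mulrA (cd a) mulrA addNr.
Qed.

(** * Splitting of the double when g0 e is a square *)

Section Split.
Variable t : W.
Hypothesis te : t * e = t.
Hypothesis tt : gam * t * t = e.

(* The idempotent (e + tu)/2, with (tu)^2 = e. *)
Definition half_idem : V := lpair (half *: e) (half *: t).
Local Notation C := (mulby half_idem A).

Lemma mul_half_idem a : a * e = a ->
  mul (lpair a 0) half_idem = lpair (half *: a) (half *: (a * t)).
Proof. by move=> ae; rewrite lpair_mull0 -scalerAr ae -scalerAl (cp te). Qed.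

Lemma mem_half x : x \in C <-> exists2 a, a * e = a & x = lpair (half *: a) (half
  *: (a * t)).
Proof.
split=> [/mem_mulby[_ /compP[a ae ->] ->]|[a ae ->]].
  by exists a; rewrite // mul_half_idem.
by apply/mem_mulby; exists (lpair a 0); rewrite ?mem_comp ?mul_half_idem.
Qed.

(** Taking t' = t gives the product within one summand, and t' = -t the orthogonality of the two. *)
Lemma half_mulE t' a b : t' * e = t' -> a * e = a -> b * e = b ->
  mul (lpair (half *: a) (half *: (a * t))) (lpair (half *: b) (half *: (b * t'))) =
  lpair (half *: (half *: (a * b * (e + gam * t * t')))) (half *: (half *: (a * b
    * (t + t')))).
Proof.
move=> te' ae be.
have sc (x : W) : x * e = x -> (half *: x) * e = half *: x by rewrite -scalerAl => ->.
have hh (x y : W) : (half *: x) * (half *: y) = half *: (half *: (x * y)).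
  by rewrite -scalerAl -scalerAr.
rewrite plus_mul ?sc ?compM // -[gam * _ * _]mulrA !hh -[gam * (half *: (half *:
  _))]scalerAr -[gam * (half *: _)]scalerAr -!scalerDr.
congr (lpair (_ *: (_ *: _)) (_ *: (_ *: _))).
  rewrite !mulrDr compM //; congr (_ + _).
  have -> : b * t' * (a * t) = a * b * (t * t').
    rewrite -!mulrA (galg_mulCA t' t (cp ae)) (galg_mulCA b _ (cp ae)).
    by rewrite (cp te' t).
  by rewrite -[gam * t * t']mulrA (galg_mulCA _ _ gam_central).
rewrite mulrDr addrC -!mulrA (cp te b); congr (_ + _).
by rewrite (cp te' a) (galg_mulCA b _ (cp ae)).
Qed.

Lemma half_mul a b : a * e = a -> b * e = b ->
  mul (lpair (half *: a) (half *: (a * t))) (lpair (half *: b) (half *: (b * t))) =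
  lpair (half *: (a * b)) (half *: (a * b * t)).
Proof.
by move=> ae be; rewrite half_mulE // tt !mulrDr !scalerDr !half_half compM.
Qed.

Lemma half_opp_mul a b : a * e = a -> b * e = b ->
  mul (lpair (half *: a) (half *: (a * t))) (lpair (half *: b) (half *: (b * - t))) = 0.
Proof.
move=> ae be; rewrite half_mulE ?mulNr ?te //.
by rewrite mulrN tt !subrr mulr0 !scaler0 lpair0.
Qed.

Lemma half_iso : algebra_iso mul A C.
Proof.
exists (linfun (loop_alg_mulr (K := K) (ra_mul s g0) half_idem)); split=> //.
  move=> _ _ /compP[a ae ->] /compP[b be ->].
  rewrite !lfunE /= /loop_alg_mulr -![loop_alg_mul _ _ _]/(mul _ _) !mul_half_idem //.
  case/lpair_inj=> /(congr1 ( *:%R 2%:R)); rewrite !scalerA mulfV // !scale1r => -> _.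
  by [].
move=> _ _ /compP[a ae ->] /compP[b be ->].
rewrite !lfunE /= /loop_alg_mulr -![loop_alg_mul _ _ _]/(mul _ _) lpair_mul0.
by rewrite !mul_half_idem ?compM // half_mul.
Qed.

End Split.

Lemma split_direct t : t * e = t -> gam * t * t = e ->
  is_direct_sum mul (fun j : 'I_2 => mulby (half_idem (if j == ord0 then t else -
    t)) A) B.
Proof.
move=> te tt.
have [teN ttN] : - t * e = - t /\ gam * - t * - t = e.
  by split; [rewrite mulNr te | rewrite (mulrN (gam * _)) (mulrN gam) mulNr opprK].
pose T (j : 'I_2) := if j == ord0 then t else - t.
have Te j : T j * e = T j by rewrite /T; case: ifP.
have TT j : gam * T j * T j = e by rewrite /T; case: ifP.
apply: direct_sum_intro.
- exact: KL_mulDr.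
- rewrite !big_ord_recl big_ord0 addv0 /=; apply/eqP; rewrite eqEsubv.
  apply/andP; split; apply/subvP=> x.
    move=> /mem_doubleP[a [b [ae be ->]]]; apply/memv_addP.
    have gb : gam * t * b * e = gam * t * b by rewrite compM.
    (* The two coordinates of a + bu are its values at u = g0 t and u = -g0 t, the two square roots
       of g0 e. *)
    exists (lpair (half *: (a + gam * t * b)) (half *: ((a + gam * t * b) * t))).
      by apply/(mem_half te); exists (a + gam * t * b); rewrite // mulrDl ae gb.
    exists (lpair (half *: (a - gam * t * b)) (half *: ((a - gam * t * b) * - t))).
      by apply/(mem_half teN); exists (a - gam * t * b); rewrite // mulrBl ae gb.
    rewrite lpairD -!scalerDr mulrN -mulNr opprB -mulrDl.
    have -> : a + gam * t * b + (a - gam * t * b) = a + a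
      by rewrite addrACA subrr addr0.
    have -> : a + gam * t * b + (gam * t * b - a) = gam * t * b + gam * t * b.
      by rewrite [a + _]addrC addrACA subrr addr0.
    rewrite mulrDl !scalerDr !half_half; congr lpair.
    by rewrite -[gam * t * b * t]mulrA (cp be t) mulrA tt ce be.
  case/memv_addP=> _ /(mem_half te)[a ae ->] [_ /(mem_half teN)[b be ->] ->].
  by rewrite memvD // mem_double // -?scalerAl ?compM ?ae ?be.
- move=> j _ _ /(mem_half (Te j))[a ae ->] /(mem_half (Te j))[b be ->].
  rewrite half_mul //; apply/(mem_half (Te j)).
  by exists (a * b); rewrite ?compM.
- move=> j; exists (lpair (half *: e) (half *: (e * T j))).
    by apply/(mem_half (Te j)); exists e.
  by move=> _ /(mem_half (Te j))[a ae ->]; rewrite half_mul // ce ae.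
move=> i j ij _ _ /(mem_half (Te i))[a ae ->] /(mem_half (Te j))[b be ->].
have -> : T j = - T i.
  rewrite /T; move: ij; case: i => [[|[|//]] ?]; case: j => [[|[|//]] ?] //= _.
  by rewrite opprK.
exact: half_opp_mul.
Qed.

End Plus.
End OneComponent.
(** * Decomposition of KG and KL *)

Hypothesis G_nonabelian : ~~ abelian [set: gT].
Local Notation double A := (A + times_u s g0 A)%VS.

Lemma sign_field e A : component e A -> is_simple mul A -> is_field mul A ->
  gelt s * e = e.
Proof.
move=> compA simA [_ _ comm _]; have [//|se] := comp_sign compA simA.
by case: (minus_noncommutative compA simA se G_nonabelian comm).
Qed.

(* In dimension at least two, x y - y x = 0 would be a linear relation between
   basis elements. *)
Lemma commutative_dim4_eq0 A F : is_commutative mul A -> (forall z, z \in F <->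
  central mul A z) ->
  is_associative mul A -> is_algebra mul A -> 
  has_dim_over mul F A 4 -> forall x, x \in A -> x = 0.
Proof.
move=> comm FP assA algA [b [bA bP]].
(* [A] is its own centre, so its elements, in particular the [b i], may serve as coefficients. *)
have FA x : x \in A -> x \in F.
  move=> xA; apply/FP; split=> // [y yA|y z yA zA]; first exact: comm.
  by rewrite !assA.
have unique (c c' : {ffun 'I_4 -> V}) : (forall i, c i \in A) -> (forall i, c' i
  \in A) ->
    \sum_(i < 4) mul (c i) (b i) = \sum_(i < 4) mul (c' i) (b i) -> c = c'.
  move=> cA c'A cc'; have sA : \sum_(i < 4) mul (c i) (b i) \in A.
    by apply: memv_suml => i _; apply: algA.
  have [d [_ ud]] := bP _ sA.
  transitivity d; [apply/esym|]; apply: ud; split=> // i; exact: FA.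
pose d1 x : {ffun 'I_4 -> V} := [ffun i => if i == ord0 then x else 0].
pose d2 x : {ffun 'I_4 -> V} := [ffun i => if i == ord_max then x else 0].
have sum1 x : \sum_(i < 4) mul (d1 x i) (b i) = mul x (b ord0).
  rewrite (bigD1 ord0) //= big1 ?addr0 ?ffunE // => i i0.
  by rewrite ffunE (negPf i0) KL_mul0l.
have sum2 x : \sum_(i < 4) mul (d2 x i) (b i) = mul x (b ord_max).
  rewrite (bigD1 ord_max) //= big1 ?addr0 ?ffunE ?eqxx // => i i0.
  by rewrite ffunE (negPf i0) KL_mul0l.
have d1A x i : x \in A -> d1 x i \in A by move=> xA; rewrite ffunE; case: ifP => _;
  rewrite ?mem0v.
have d2A x i : x \in A -> d2 x i \in A by move=> xA; rewrite ffunE; case: ifP => _;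
  rewrite ?mem0v.
have b0 : b ord0 = 0.
  (* The products of the first and last basis elements in both orders are two expansions of one
     vector; comparing last coefficients gives [b ord0 = 0]. *)
  have e12 : d2 (b ord0) = d1 (b ord_max).
    by apply: unique => [i|i|]; rewrite ?d1A ?d2A // sum1 sum2 comm.
  by have /ffunP/(_ ord_max) := e12; rewrite !ffunE.
(* Since [b ord0] vanishes, its coefficient is arbitrary, and uniqueness forces every x to be 0. *)
move=> x xA; have e1 : d1 x = d1 0.
  apply: unique => [i|i|]; rewrite ?d1A ?mem0v //.
  by rewrite !sum1 b0 !KL_mul0r.
by have /ffunP/(_ ord0) := e1; rewrite !ffunE.
Qed.

Lemma sign_quaternion e A : component e A -> is_simple mul A -> is_quaternion mul A ->
  gelt s * e = - e.
Proof.
move=> compA simA [F [_ [FP _ dimA]]].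
have [se|//] := comp_sign compA simA;
  have [algA assA comm _] := plus_field compA simA se.
have [ce ee _] := compA.
have /lpair_eq0[e0 _] := commutative_dim4_eq0 comm FP assA algA dimA (mem_comp
  compA ee).
by case/eqP: (comp_neq0 compA simA).
Qed.

Lemma simple_field_or_quaternion e A : component e A -> is_simple mul A ->
  is_field mul A \/ is_quaternion mul A.
Proof.
move=> compA simA; have [se|se] := comp_sign compA simA.
  by left; apply: plus_field compA simA se.
by right; exists (centerF A); apply: minus_quaternion compA simA se.
Qed.

Lemma double_cases e A : component e A -> is_simple mul A ->
  [\/ is_field mul (double A),
      is_field mul A /\
      (exists C : 'I_2 -> {vspace V}, is_direct_sum mul C (double A) /\
         forall j, algebra_iso mul A (C j)) |
      is_Cayley mul (double A)].
Proof.
move=> compA simA; have [se|se] := comp_sign compA simA; last first.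
  by apply: Or33; apply: double_Cayley compA simA se.
(* Such a t is the inverse, in the field [A], of a square root of g0 e. *)
have [[t [te tt]]|nonsq] := classic (exists t, t * e = t /\ gam * t * t = e);
  last first.
  by apply: Or31; apply: plus_double_field compA simA se nonsq.
apply: Or32; split; first exact: plus_field compA simA se.
exists (fun j => mulby (half_idem e (if j == ord0 then t else - t)) A).
split; first exact: split_direct.
move=> j /=; apply: half_iso => //; first by case: ifP => _; rewrite ?mulNr te.
by case: ifP => _ //; rewrite (mulrN (gam * _)) (mulrN gam) mulNr opprK.
Qed.

Lemma summand_ideal (J : finType) (D : J -> {vspace V}) A :
  is_direct_sum mul D A -> forall j, is_ideal mul A (D j).
Proof.
case=> -> _ algD ortho j; split=> [|x y]; first by rewrite (sumv_sup j).
case/memv_sumP=> v vD -> yD; rewrite KL_mul_suml KL_mul_sumr.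
split; apply: memv_suml => i _; have [ij|ij] := eqVneq i j.
- by apply: algD => //; rewrite -ij vD.
- by rewrite (ortho i j) ?vD ?mem0v.
- by apply: algD => //; rewrite -ij vD.
- by rewrite (ortho j i) ?vD ?mem0v // eq_sym.
Qed.

(** [I] has a central identity e, so for y in [A] the product ay equals (ae)y, with ae in [I]. *)
Lemma ideal_trans I A : is_ideal mul KG I -> is_ideal mul I A -> is_ideal mul KG A.
Proof.
move=> idI [sAI idA]; have [e compI] := ideal_component idI; have [ce ee _] := compI.
split=> [|x y]; first exact: subv_trans sAI idI.1.
case/mem_KG=> a -> yA; have /(compP compI)[b be yb] := subvP sAI _ yA.
have [] := idA (lpair (a * e) 0) y (mem_comp_e compI a) yA; rewrite yb !lpair_mul0.
by rewrite -[a * e * b]mulrA ce be mulrA (compMl compI).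
Qed.

(** bar preserves each component, so every term of the product formula contains factors from both
    and dies with ee' = 0. *)
Lemma component_orthogonal e e' A A' : component e A -> component e' A' -> e * e' = 0 ->
  {in double A & double A', forall x y, mul x y = 0}.
Proof.
move=> compA compA' ee' x y /(mem_doubleP compA)[a [b [ae be ->]]].
case/(mem_doubleP compA')=> [c [d [ec de ->]]].
have [ce _ _] := compA; have [ce' _ _] := compA'.
have ac0 p q : p * e = p -> q * e' = q -> p * q = 0.
  by move=> <- <-; rewrite -mulrA (ce (q * e')) -[q * e' * e]mulrA -(ce e') ee' !mulr0.
have ca0 p q : p * e = p -> q * e' = q -> q * p = 0.
  by move=> <- <-; rewrite -mulrA (ce' (p * e)) -[p * e * e']mulrA ee' !mulr0.
rewrite lpair_mul // (ac0 a) // (ca0 a) // (ac0 b) ?(comp_bar compA') //.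
by rewrite -mulrA (ca0 b) ?(comp_bar compA') // mulr0 !addr0 lpair0.
Qed.

Lemma double_direct_sum (J : finType) (A : J -> {vspace V}) :
  is_direct_sum mul A KG -> is_direct_sum mul (fun j => double (A j)) fullv.
Proof.
move=> dsA; have idA := summand_ideal dsA.
have comp j := ideal_component (idA j).
have [defKG _ _ ortho] := dsA.
apply: direct_sum_intro.
- exact: KL_mulDr.
- apply/eqP; rewrite eqEsubv subvf andbT; apply/subvP => x _.
  rewrite (lpair_eta x); move: (lfst x) (lsnd x) => a b.
  have inKG c : lpair c 0 \in (\sum_j A j)%VS by rewrite -defKG; apply/mem_KG; exists c.
  have /memv_sumP[v vA av] := inKG a; have /memv_sumP[w wA bw] := inKG b.
  have -> : lpair a b = \sum_j (v j + mul (w j) (lpair 0 1)).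
    by rewrite big_split /= -KL_mul_suml -av -bw mul_u // lpairD addr0 add0r.
  apply: memv_sumr => j _; have [e compA] := comp j; apply: memv_add; first exact: vA.
  have /(compP compA)[c ec ->] := wA j isT; rewrite mul_u.
  by apply/(mem_times_u compA); exists c.
- by move=> j; have [e compA] := comp j; apply: (double_algebra compA).
- move=> j; have [e compA] := comp j; have [eB e1] := double_identity compA.
  by exists (lpair e 0) => // x /e1[].
move=> i j ij; have [e compA] := comp i; have [e' compA'] := comp j.
apply: (component_orthogonal compA compA').
have [_ ee _] := compA; have [_ ee' _] := compA'.
have := ortho i j ij _ _ (mem_comp compA ee) (mem_comp compA' ee').
by rewrite lpair_mul0 => /lpair_eq0[].
Qed.

(** Induction on dimension: a proper nonzero ideal J with identity e' is complemented in I by I(e -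
    e'), and both are ideals of [KG] by [ideal_trans]. *)
Lemma wedderburn_exists I : is_ideal mul KG I ->
  exists (r : nat) (A : 'I_r -> {vspace V}), is_wedderburn mul A I.
Proof.
have [n] := ubnP (\dim I); elim: n I => // n IH I leIn idI.
have [e compI] := ideal_component idI; have [ce ee eP] := compI.
have [I0|I0] := eqVneq I 0%VS.
  (* The index type is empty, so the value [I] is a dummy. *)
  exists 0%N, (fun=> I); split; last by case.
  apply: direct_sum_intro => [|||[]|[]] //; first exact: KL_mulDr.
    by rewrite big_ord0.
  by case.
have [[J [idJ [/eqP J0 /eqP JI]]]|simI] :=
    classic (exists J, is_ideal mul I J /\ J <> 0%VS /\ J <> I); last first.
  exists 1%N, (fun=> I); split=> [|_].
    apply: direct_sum_intro => [||_|_|i j].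
    - exact: KL_mulDr.
    - by rewrite big_ord1.
    - exact: comp_algebra compI.
    - have [eI e1] := comp_identity compI.
      by exists (lpair e 0) => // x /e1[].
    by rewrite !ord1.
  split.
  - exact: comp_algebra compI.
  - exists (lpair e 0), (lpair e 0); rewrite (mem_comp compI ee) lpair_mul0 // ee;
    split=> //.
    apply: contra_neq I0 => /lpair_eq0[e0 _]; apply/eqP; rewrite -subv0.
    by apply/subvP=> _ /eP[a <- ->]; rewrite e0 mulr0 lpair0 mem0v.
  move=> J idJ; apply: NNPP => nJ; apply: simI; exists J.
  by split=> //; split=> JE; apply: nJ; [left | right].
have idJG := ideal_trans idI idJ.
have [e' compJ] := ideal_component idJG.
have [ce' ee' eP'] := compJ; have sJI := idJ.1.
have e'e : e' * e = e' by apply: (mem_comp_inv compI); apply: (subvP sJI);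
  apply: (mem_comp compJ).
have e'J0 : (e' == 0) = false.
  apply: contraNF J0 => /eqP e0; rewrite -subv0.
  by apply/subvP=> _ /eP'[a <- ->]; rewrite e0 mulr0 lpair0 mem0v.
pose e'' := e - e'; pose J' := mulby (lpair e'' 0) I.
have idJ' : is_ideal mul I J'.
  by apply: (comp_mulby_ideal compI); apply: galg_centralB.
have idJ'G := ideal_trans idI idJ'.
have e'e'' : e' * e'' = 0 by rewrite mulrBr e'e ee' subrr.
have compJ' : component e'' J'.
  have ee'' : e'' * e'' = e'' by rewrite {1}/e'' mulrBl e'e'' mulrBr ee ce e'e subr0.
  have e''e : e'' * e = e'' by rewrite mulrBl ee e'e.
  split=> //; first exact: galg_centralB.
  move=> x; split=> [/mem_mulby[_ /eP[a ae ->] ->]|[a ae ->]].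
    by rewrite lpair_mul0; exists (a * e''); rewrite // -mulrA ee''.
  apply/mem_mulby; exists (lpair a 0); last by rewrite lpair_mul0 ae.
  by apply: (mem_comp compI); rewrite -ae -mulrA e''e.
have ltdim A : (A <= I)%VS -> A != I -> (\dim A < n)%N.
  move=> sAI neAI; apply: leq_trans (leIn : (\dim I <= n)%N);
    rewrite ltn_neqAle dimvS // andbT.
  by apply: contra neAI => /eqP dAI; rewrite eqEdim sAI dAI /=.
(* Otherwise e' would lie in J', giving e' = e'e'' = 0. *)
have neJ' : J' != I.
  apply: contraFneq e'J0 => J'I; have e'J' : lpair e' 0 \in J'.
    by rewrite J'I; apply: (mem_comp compI).
  by apply/eqP; rewrite -(mem_comp_inv compJ' e'J').
have [r1 [A1 [ds1 sim1]]] := IH J (ltdim J sJI JI) idJG.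
have [r2 [A2 [ds2 sim2]]] := IH J' (ltdim J' idJ'.1 neJ') idJ'G.
pose A (k : 'I_(r1 + r2)) := match split k with inl i => A1 i | inr i => A2 i end.
have idA k : is_ideal mul KG (A k).
  rewrite /A; case: split => i.
    exact: ideal_trans idJG (summand_ideal ds1 i).
  exact: ideal_trans idJ'G (summand_ideal ds2 i).
exists (r1 + r2)%N, A; split=> [|k]; last by rewrite /A; case: split.
have AE1 i : A (lshift r2 i) = A1 i by rewrite /A (unsplitK (inl i)).
have AE2 i : A (rshift r1 i) = A2 i by rewrite /A (unsplitK (inr i)).
have IJ : I = (J + J')%VS.
  apply/eqP; rewrite eqEsubv subv_add sJI idJ'.1 !andbT; apply/subvP=> _ /eP[a ae ->].
  have -> : lpair a 0 = lpair (a * e') 0 + lpair (a * e'') 0.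
    by rewrite lpairD addr0 mulrBr ae addrC subrK.
  apply: memv_add; first exact: (mem_comp_e compJ).
  exact: (mem_comp_e compJ').
have sub1 i : (A1 i <= J)%VS by case: (summand_ideal ds1 i).
have sub2 i : (A2 i <= J')%VS by case: (summand_ideal ds2 i).
have JJ' : {in J & J', forall x y, mul x y = 0 /\ mul y x = 0}.
  move=> x y xJ yJ'; split.
    apply: (component_orthogonal compJ compJ' e'e''); exact: (subvP (subv_double _)).
  apply: (component_orthogonal compJ' compJ); rewrite -?ce' //;
    exact: (subvP (subv_double _)).
apply: direct_sum_intro.
- exact: KL_mulDr.
- rewrite big_split_ord IJ; have [-> _ _ _] := ds1; have [-> _ _ _] := ds2.
  by congr (_ + _)%VS; apply: eq_bigr => i _; rewrite ?AE1 ?AE2.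
- by move=> k; rewrite /A; case: split => i; [case: ds1 | case: ds2].
- move=> k; have [f compk] := ideal_component (idA k).
  by have [fA f1] := comp_identity compk; exists (lpair f 0) => // x /f1[].
have [_ _ _ ortho1] := ds1; have [_ _ _ ortho2] := ds2.
move=> k l; rewrite -(splitK k) -(splitK l).
case: (split k) (split l) => [i|i] [j|j] kl x y /=; rewrite ?AE1 ?AE2 => xA yA.
- by apply: (ortho1 i j) => //; apply: contra_neq kl => ->.
- by case: (JJ' x y) => //; [exact: (subvP (sub1 i)) | exact: (subvP (sub2 j))].
- by case: (JJ' y x) => //; [exact: (subvP (sub1 j)) | exact: (subvP (sub2 i))].
- by apply: (ortho2 i j) => //; apply: contra_neq kl => ->.
Qed.

Lemma KG_ideal : is_ideal mul KG KG.
Proof.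
split=> // _ _ /mem_KG[a ->] /mem_KG[b ->]; rewrite !lpair_mul0.
by split; apply/mem_KG; eexists.
Qed.

(** Each given field has s acting as 1, and its double splits since g0 is a square; each given
    quaternion algebra has s acting as -1, and its double is a Cayley algebra. *)
Lemma sum_of_fields_double h n m : g0 = (h * h)%g ->
  sum_of_fields_and mul (is_quaternion mul) n m KG ->
  sum_of_fields_and mul (is_Cayley mul) (2 * n) m fullv.
Proof.
move=> g0h [A [dsA fA qA]]; have idA := summand_ideal dsA.
have compE j : exists e, component e (A j) := ideal_component (idA j).
have /fin_all_exists[e compA] := compE.
have simA j : is_simple mul (A j).
  case: j => j; first by apply: field_simple (fA j); apply: KL_mul0r.
  by have [F [[_ _ simQ] _]] := qA j.
(* With g0 = hh, the element h^-1 e solves g0 tt = e; h itself may be noncentral, as only e has to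
   move past it. *)
pose t j := gelt h^-1 * e j.
have te j : t j * e j = t j by rewrite -mulrA; have [_ -> _] := compA j.
have tt j : gam * t j * t j = e j.
  have [ce ee _] := compA j.
  have hVK x : gelt h * (gelt h^-1 * x) = x by rewrite mulrA -geltM mulgV mul1r.
  by rewrite /t g0h geltM -!mulrA hVK ce -mulrA ee hVK.
have se j : gelt s * e (inl j) = e (inl j) := sign_field (compA _) (simA _) (fA j).
pose sgn (i : 'I_2) j := if i == ord0 then t j else - t j.
pose C (p : 'I_n * 'I_2) := mulby (half_idem (e (inl p.1)) (sgn p.2 (inl p.1)))
  (A (inl p.1)).
have dsC i : is_direct_sum mul (fun j => C (i, j)) (double (A (inl i))).
  exact: (split_direct (compA (inl i)) (se i) (te (inl i)) (tt (inl i))).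
have card2n : (2 * n)%N = #|{: 'I_n * 'I_2}| by rewrite card_prod !card_ord mulnC.
(* The new fields are indexed by pairs: a field of [KG] and a sign for t. *)
pose f (k : 'I_(2 * n)) : 'I_n * 'I_2 := enum_val (cast_ord card2n k).
have bij_f : bijective f.
  apply: (@Bijective _ _ _ (fun p => cast_ord (esym card2n) (enum_rank p))) => x.
    by rewrite /f enum_valK cast_ordK.
  by rewrite /f cast_ordKV enum_rankK.
pose D (j : 'I_(2 * n) + 'I_m) := match j with inl k => C (f k) | inr k => double
  (A (inr k)) end.
have [defV _ algB orthoB] := double_direct_sum dsA.
have CB p : (C p <= double (A (inl p.1)))%VS.
  by case: p => i j; case: (summand_ideal (dsC i) j).
have fieldC p : is_field mul (C p).
  have sgne : sgn p.2 (inl p.1) * e (inl p.1) = sgn p.2 (inl p.1).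
    by rewrite /sgn; case: ifP => _; rewrite ?mulNr te.
  have sgn2 : gam * sgn p.2 (inl p.1) * sgn p.2 (inl p.1) = e (inl p.1).
    by rewrite /sgn; case: ifP => _ //;
      rewrite (mulrN (gam * _)) (mulrN gam) mulNr opprK.
  exact: algebra_iso_field (half_iso (compA (inl p.1)) (se p.1) sgne sgn2) (fA p.1).
exists D; split.
- apply: direct_sum_intro.
  + exact: KL_mulDr.
  + rewrite defV !big_sumType /=; congr (_ + _)%VS.
    have <- : (\sum_p C p = \sum_k C (f k))%VS.
      by apply: reindex; apply: onW_bij.
    transitivity (\sum_i \sum_j C (i, j))%VS.
      by apply: eq_bigr => i _; case: (dsC i).
    by rewrite (pair_bigA _ (fun i j => C (i, j))); apply: eq_bigr => -[].
  + move=> [k|k] /=; [by case: (fieldC (f k)) | exact: algB].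
  + move=> [k|k] /=; last first.
      have [eB e1] := double_identity (compA (inr k)).
      by exists (lpair (e (inr k)) 0) => // x /e1[].
    have [_ _ _ [d [[dC d1] _ _]]] := fieldC (f k).
    by exists d => // x /d1[].
  move=> [k|k] [l|l] kl x y /= xD yD.
  + have fkl : f k != f l by apply: contra_neq kl => /(bij_inj bij_f)->.
    case: (f k) (f l) fkl xD yD => i j [i' j'] /= ne xD yD.
    have [ii'|ii'] := eqVneq i i'.
      rewrite -ii' in ne yD; have [_ _ _ orthoC] := dsC i.
      by apply: (orthoC j j') => //; apply: contra_neq ne => ->.
    apply: (orthoB (inl i) (inl i')); [by apply: contra_neq ii' => -[] | |].
      exact: (subvP (CB (i, j))).
    exact: (subvP (CB (i', j'))).
  + by apply: (orthoB (inl (f k).1) (inr l)) => //; apply: (subvP (CB _)).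
  + by apply: (orthoB (inr k) (inl (f l).1)) => //; apply: (subvP (CB _)).
  + by apply: (orthoB (inr k) (inr l)) => //; apply: contra_neq kl => -[->].
- by move=> k; apply: fieldC.
by move=> k; apply: double_Cayley (compA _) (simA _) (sign_quaternion (compA _)
  (simA _) (qA k)).
Qed.

End Components.

(** * The five classes and the decomposition theorem *)

Lemma class_square (gT : finGroupType) (g0 : gT) :
  [\/ in_L1 g0, in_L2 g0, in_L3 g0 | (in_L4 g0 \/ in_L5 g0)] ->
  exists h, g0 = (h * h)%g.
Proof.
case=> [[m [x [y [t [_ _ ->]]]]]|[m [x [y [t [_ [_ [_ xx _] _] ->]]]]]|
        [m [x [y [t [_ _ ->]]]]]|].
- by exists 1%g; rewrite mulg1.
- by exists x; rewrite -xx.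
- by exists 1%g; rewrite mulg1.
case=> [[m [x [y [t [_ [_ [_ xx _] _] ->]]]]]|[m [x [y [t [_ _ ->]]]]]].
- by exists x; rewrite -xx.
by exists 1%g; rewrite mulg1.
Qed.

Theorem theorem8p2 (gT : finGroupType) (s g0 : gT) (K : fieldType)
    (G_nonabelian : ~~ abelian [set: gT])
    (G_mod_Z : ([set: gT] / 'Z([set: gT]))%g \isog [set: ('Z_2 * 'Z_2)%type])
    (s_neq1 : s != 1%g)
    (G_der : ([set: gT]^`(1))%g = [set 1%g; s])
    (g0_central : g0 \in 'Z([set: gT])%g)
    (K_char : [pchar K]^'.-nat #|ra_loop gT|) :
  let mul := KL_mul (K := K) s g0 in
  [/\ exists (r : nat) (A : 'I_r -> {vspace KL gT K}),
        is_wedderburn mul A (KG gT K),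
      forall (r : nat) (A : 'I_r -> {vspace KL gT K}),
        is_wedderburn mul A (KG gT K) ->
        let B := fun i => (A i + times_u s g0 (A i))%VS in
        [/\ forall i, is_field mul (A i) \/ is_quaternion mul (A i),
            is_direct_sum mul B fullv &
            forall i,
              [\/ is_field mul (B i),
                  is_field mul (A i) /\
                  (exists C : 'I_2 -> {vspace KL gT K},
                     is_direct_sum mul C (B i) /\
                     forall j, algebra_iso mul (A i) (C j)) |
                  is_Cayley mul (B i)]] &
      [\/ in_L1 g0, in_L2 g0, in_L3 g0 | (in_L4 g0 \/ in_L5 g0)] ->
      forall n m : nat,
        sum_of_fields_and mul (is_quaternion mul) n m (KG gT K) ->
        sum_of_fields_and mul (is_Cayley mul) (2 * n) m fullv].
Proof.
move=> mul.
(* The loop has 2|G| elements, so both factors are nonzero in K. *)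
have /andP[two_neq0 card_neq0] : (2%:R != 0 :> K) && (#|gT|%:R != 0 :> K).
  rewrite -negb_or -mulf_eq0 -natrM natf_neq0_pchar.
  by move: K_char; rewrite card_sum addnn -mul2n.
split.
- exact/wedderburn_exists/KG_ideal.
- move=> r A [dsA simA] B.
  have compA i := ideal_component s_neq1 G_der card_neq0 (summand_ideal dsA i).
  split=> [i||i].
  + by have [e compAi] := compA i; apply: simple_field_or_quaternion compAi (simA i).
  + exact: double_direct_sum.
  + by have [e compAi] := compA i; apply: double_cases compAi (simA i).
move=> /class_square[h g0h] n m; exact: sum_of_fields_double g0h.
Qed.
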